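(* In the randomized call-once (CO) model with $n$ agents, asymptotically almost surely (as $n\to\infty$): 1. the number of calls until two fixed agents exchange their secrets is $\frac12 n\log n\cdot(1+o(1))$; 2. the number of calls until at least one of the agents becomes an expert is $n\log n\cdot(1+o(1))$; 3. the number of calls until a fixed agent becomes an expert is $n\log n\cdot(1+o(1))$; 4. the number of calls until all agents become experts is $\frac32 n\log n\cdot(1+o(1))$.
   Context: There are $n$ agents, each initially knowing a single distinct secret. Agents communicate by a sequence of calls between pairs of distinct agents; in each call the two agents exchange all secrets they currently know. An agent who knows all $n$ secrets is an expert. Two fixed agents have exchanged their secrets once each knows the secret of the other. In the randomized call-once (CO) model, each next call is between a pair of agents chosen uniformly at random among all pairs of distinct agents that have not called each other before (so every pair calls at most once, and the sequence of calls is a uniformly random ordering of all $\binom n2$ pairs). $\log$ is the natural logarithm. A statement ''$X=f(n)(1+o(1))$ a.a.s.'' means that for every $\delta>0$, $\mathbb P[(1-\delta)f(n)\le X\le(1+\delta)f(n)]\to1$ as $n\to\infty$. *)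

(* Defs.v *)
From HB Require Import structures.
From mathcomp Require Import all_boot all_order all_algebra.
From mathcomp Require Import all_classical all_reals all_analysis.
Set Implicit Arguments.
Unset Strict Implicit.
Unset Printing Implicit Defensive.
Import Order.TTheory GRing.Theory Num.Theory.
Import numFieldNormedType.Exports.
Local Open Scope ring_scope.

(* The agents are the elements of 'I_n, the secret of an agent is identified  *)
(* with that agent, and a call is a set of two agents.                        *)

Section Gossip.
Variable n : nat.

Definition knowledge := {ffun 'I_n -> {set 'I_n}}.

Definition init_knowledge : knowledge := [ffun a => [set a]%SET].

Definition make_call (K : knowledge) (e : {set 'I_n}) : knowledge :=
  [ffun a => if a \in e then \bigcup_(b in e) K b else K a]%SET.

Definition knowledge_after (s : seq {set 'I_n}) : knowledge :=
  foldl make_call init_knowledge s.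

Definition expert (a : 'I_n) (K : knowledge) : bool := K a == [set: 'I_n]%SET.

Definition exchanged (a b : 'I_n) (K : knowledge) : bool :=
  (b \in K a) && (a \in K b).

Definition some_expert (K : knowledge) : bool := [exists a, expert a K].

Definition all_experts (K : knowledge) : bool := [forall a, expert a K].

(* The least t such that Q holds after the first t calls of s, or             *)
(* (size s).+1 if there is none, which by all_experts_end does not happen for *)
(* the four properties above once s contains all the pairs.                   *)
Definition calls_until (Q : pred knowledge) (s : seq {set 'I_n}) : nat :=
  find (fun t : nat => Q (knowledge_after (take t s))) (iota 0 (size s).+1).

Definition pairs : {set {set 'I_n}} := [set e : {set 'I_n} | #|e| == 2]%SET.

Definition available (s : seq {set 'I_n}) : {set {set 'I_n}} :=
  [set e in pairs | e \notin s]%SET.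

Definition co_seq := 'C(n, 2).-tuple {set 'I_n}.

Variable R : realType.

Definition co_step (s : seq {set 'I_n}) (e : {set 'I_n}) : R :=
  if e \in available s then #|available s|%:R^-1 else 0.

Definition co_mass (s : co_seq) : R :=
  \prod_(i < 'C(n, 2)) co_step (take i s) (tnth s i).

Definition co_prob (A : pred co_seq) : R := \sum_(s | A s) co_mass s.

End Gossip.

Arguments co_prob {n R} A.

(* X n is a random variable of the model with n.+2 agents (so that two        *)
(* distinct agents exist); f is a function of the number of agents.           *)
Definition aas_asymp (R : realType) (X : forall n, co_seq n.+2 -> nat)
    (f : nat -> R) : Prop :=
  forall delta : R, 0 < delta ->
    ((fun n : nat => co_prob (fun s : co_seq n.+2 =>
        ((1 - delta) * f n.+2 <= (X n s)%:R <= (1 + delta) * f n.+2)%R) : R)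
      @ \oo --> (1 : R))%classic.

Lemma card_pairs n : #|pairs n| = 'C(n, 2).
Proof. by rewrite card_draws card_ord. Qed.

Lemma co_massE n (R : realType) (s : co_seq n) :
  co_mass R s = if all (mem (pairs n)) s && uniq s then ('C(n, 2))`!%:R^-1 else 0.
Proof.
rewrite /co_mass; case: ifPn => [/andP[/allP sP us]|].
  have -> : ('C(n, 2))`!%:R^-1 = \prod_(i < 'C(n, 2)) ('C(n, 2) - i)%:R^-1 :> R.
    by rewrite -ffactnn ffact_prod natr_prod prodfV.
  apply: eq_bigr => i _; rewrite /co_step.
  have ilt : (i < size s)%N by rewrite size_tuple.
  have -> : #|available (take i s)| = ('C(n, 2) - i)%N.
    have -> : available (take i s) = (pairs n :\: [set e in take i s])%SET.
      by apply/setP => e; rewrite !inE andbC.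
    rewrite cardsD card_pairs; congr (_ - _)%N.
    have -> : (pairs n :&: [set e in take i s])%SET = [set e in take i s]%SET.
      apply/finset.setIidPr/fintype.subsetP => e; rewrite inE => /mem_take; exact: sP.
    by rewrite cardsE (card_uniqP (take_uniq i us)) size_take ilt.
  have sPi : tnth s i \in pairs n by apply: sP; apply: mem_tnth.
  rewrite inE sPi /= (tnth_nth (tnth s i)).
  have := us; rewrite -{1}(cat_take_drop i s) (drop_nth (tnth s i)) //.
  by rewrite cat_uniq /= negb_or => /and3P[_ /andP[/negPf-> _] _].
move=> bad; apply/eqP; rewrite prodf_seq_eq0; apply: contraR bad => /hasPn H.
have {}H (i : 'I_('C(n, 2))) : tnth s i \in available (take i s).
  have := H i (mem_index_enum _); rewrite /co_step /=.
  by case: ifP => //; rewrite eqxx.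
apply/andP; split.
  by apply/all_tnthP => i; have := H i; rewrite inE => /andP[].
apply/(uniqP (finset.set0)) => i j; rewrite !inE !size_tuple => iN jN.
wlog ij : i j iN jN / (i < j)%N => [W|].
  by case: (ltngtP i j) => // [/W|/W W' /esym] h; [apply: h|symmetry; apply: W'].
have := H (Ordinal jN); rewrite inE => /andP[_ /=].
rewrite (tnth_nth finset.set0) /= => /negP nin eij; case: nin; rewrite -eij.
rewrite -(nth_take _ ij); apply: mem_nth.
by rewrite size_take size_tuple jN.
Qed.

Lemma co_prob_unif n (R : realType) (A : pred (co_seq n)) :
  co_prob A = #|[set s : co_seq n | A s && (all (mem (pairs n)) s && uniq s)]%SET|%:R
              / ('C(n, 2))`!%:R :> R.
Proof.
rewrite /co_prob -sum1_card natr_sum big_distrl /= [RHS]big_mkcond /=.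
rewrite [LHS]big_mkcond /=; apply: eq_bigr => s _; rewrite co_massE inE.
by case: (A s) => //=; case: ifP; rewrite ?mul1r.
Qed.

Lemma co_prob_total n (R : realType) : co_prob (fun _ : co_seq n => true) = 1 :> R.
Proof.
rewrite co_prob_unif /= (card_uniq_tuples 'C(n, 2) (mem (pairs n))) card_pairs.
by rewrite ffactnn divff // pnatr_eq0 -lt0n fact_gt0.
Qed.

Lemma make_call_mono n (K : knowledge n) e a : K a \subset make_call K e a.
Proof. by rewrite ffunE; case: ifP => // ae; apply: finset.bigcup_sup. Qed.

Lemma foldl_make_call_mono n (s : seq {set 'I_n}) (K : knowledge n) a :
  K a \subset foldl (@make_call n) K s a.
Proof.
elim: s K => //= e s IH K.
exact: fintype.subset_trans (make_call_mono K e a) (IH _).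
Qed.

Lemma all_experts_end n (s : seq {set 'I_n}) :
  {subset pairs n <= s} -> all_experts (knowledge_after s).
Proof.
move=> sP; apply/forallP => a; rewrite /expert -finset.subTset.
apply/fintype.subsetP => b _; rewrite /knowledge_after.
have self (s' : seq {set 'I_n}) c : c \in foldl (@make_call n) (init_knowledge n) s' c.
  apply: (fintype.subsetP (foldl_make_call_mono s' _ c)).
  by rewrite ffunE finset.set11.
have [->|ab] := eqVneq b a; first exact: self.
have /sP : [set a; b]%SET \in pairs n by rewrite inE cards2 (eq_sym a) ab.
case/splitPr => s1 s2; rewrite foldl_cat /=.
apply: (fintype.subsetP (foldl_make_call_mono s2 _ a)).
rewrite ffunE finset.set21; apply/finset.bigcupP; exists b; first exact: finset.set22.
exact: self.
Qed.

Lemma calls_until_le n (Q : pred (knowledge n)) (s : seq {set 'I_n}) :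
  Q (knowledge_after s) -> (calls_until Q s <= size s)%N.
Proof.
move=> Qs; rewrite /calls_until -ltnS -[X in (_ < X)%N](size_iota 0) -has_find.
by apply/hasP; exists (size s); rewrite ?mem_iota ?ltnSn ?take_size.
Qed.

(* Main.v *)
Require Import Defs.
From HB Require Import structures.
From mathcomp Require Import all_boot all_order all_algebra.
From mathcomp Require Import reals.
From mathcomp Require Import ring lra zify.
Set Implicit Arguments.
Unset Strict Implicit.
Unset Printing Implicit Defensive.
Import Order.TTheory GRing.Theory Num.Theory.
Local Open Scope ring_scope.

(** Every estimate comes from a potential [phi] of the history [s] of calls whose
    mean over the available calls is at most [c * phi s], so that its expectation
    after [m] calls is at most [c ^+ m] times its initial value. Write [N] for the
    number of pairs and [X] for the set of agents that know the secret of [a].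

    - Lower bounds. [eps n [b \in X] + #|X|] grows by [1 + (1 + eps) n / (N - m)],
      which bounds the probability that [b] knows the secret of [a]. The product
      of the [(#|X| + i) / (n - #|X| + 1 + i)] over [i < k] grows by
      [1 + k (n + k) / (N - m)] whatever the size of [X], and goes from about
      [n ^- k] to about [n ^+ k] while [X] goes from one agent to all of them;
      with [k] large the resulting bound survives a union over the agents.
      Reversing the order of the calls exchanges "[a] is an expert" and "all know
      the secret of [a]". Finally, if [I] is the set of agents without any call,
      [1 / (#|I| + 1)] grows by [1 + n / (N - m)]: after almost [n log n / 2] calls
      there still is such an agent, whose secret then needs [n log n] further calls.
    - Upper bounds. While all degrees are at most [eps n], the potential
      [[b \notin X] / (#|X| - 1)] (with value [1 / eps] when [#|X| = 1]) shrinks by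
      about [1 - 2 / n], so that [b] fails to know the secret of [a] after
      [(1 + delta) j / 2 * n log n] calls with probability [o(n ^- (j - 1))]. The
      cases [j = 1, 2, 3] give the three upper bounds by summing over the pair,
      over the secrets, and over all pairs. *)

(** * Conditional expectations over the random sequence of calls *)

Section Expectation.
Variables (n : nat) (R : realType).
Implicit Types (s : seq {set 'I_n}) (e : {set 'I_n}) (F G : seq {set 'I_n} -> R).

(** Mean of [F] after [k] more calls, given the history [s]. The recursion on the next call lets
    one-step estimates be iterated by induction; [expect_tuple] and [co_prob_pr] link it to
    [co_prob]. *)
Fixpoint expect (k : nat) s F : R :=
  if k is k'.+1 then \sum_e co_step R s e * expect k' (rcons s e) F else F s.

Definition pr (k : nat) (A : pred (seq {set 'I_n})) : R :=
  expect k [::] (fun s => (A s)%:R).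

(** These are the histories of positive probability: [co_step] vanishes off [available s], so
    estimates are only needed here. *)
Definition valid s := all (mem (pairs n)) s && uniq s.

Lemma valid_rcons s e : e \in available s -> valid s -> valid (rcons s e).
Proof.
by rewrite inE /valid all_rcons rcons_uniq => /andP[/= -> ->].
Qed.

Lemma card_available s : valid s -> #|available s| = ('C(n, 2) - size s)%N.
Proof.
move=> /andP[/allP sP us].
have -> : available s = (pairs n :\: [set e in s])%SET.
  by apply/setP => e; rewrite !inE andbC.
rewrite cardsD card_pairs; congr (_ - _)%N.
have -> : (pairs n :&: [set e in s])%SET = [set e in s]%SET.
  by apply/setIidPr/subsetP => e; rewrite inE => /sP.
by rewrite cardsE; apply/card_uniqP.
Qed.

Lemma co_step_ge0 s e : 0 <= co_step R s e.
Proof. by rewrite /co_step; case: ifP => // _; rewrite invr_ge0 ler0n. Qed.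

Lemma sum_co_step s (f : {set 'I_n} -> R) :
  \sum_e co_step R s e * f e = (\sum_(e in available s) f e) / #|available s|%:R.
Proof.
rewrite big_distrl /= [RHS]big_mkcond /=; apply: eq_bigr => e _.
by rewrite /co_step; case: ifP => _; rewrite ?mul0r // mulrC.
Qed.

Lemma expect_le k s F G : valid s ->
  (forall s', valid s' -> size s' = (size s + k)%N -> F s' <= G s') ->
  expect k s F <= expect k s G.
Proof.
elim: k s => [|k IH] s vs FG /=; first by apply: FG; rewrite ?addn0.
apply: ler_sum => e _; have [es|es] := boolP (e \in available s); last first.
  by rewrite /co_step (negPf es) !mul0r.
apply: ler_wpM2l; first exact: co_step_ge0.
apply: IH => [|s' vs' ss']; first exact: valid_rcons.
by apply: FG; rewrite // ss' size_rcons addSnnS.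
Qed.

Lemma expect_add k1 k2 s F :
  expect (k1 + k2) s F = expect k1 s (fun s' => expect k2 s' F).
Proof. by elim: k1 s => //= k1 IH s; apply: eq_bigr => e _; rewrite IH. Qed.

Lemma expect_sum k s (I : Type) (r : seq I) (P : pred I) (F : I -> seq {set 'I_n} -> R) :
  expect k s (fun s' => \sum_(i <- r | P i) F i s')
  = \sum_(i <- r | P i) expect k s (F i).
Proof.
elim: k s => //= k IH s; rewrite exchange_big; apply: eq_bigr => e _.
by rewrite IH big_distrr.
Qed.

Lemma expectD k s F G :
  expect k s (fun s' => F s' + G s') = expect k s F + expect k s G.
Proof.
elim: k s => //= k IH s; rewrite -big_split; apply: eq_bigr => e _.
by rewrite IH mulrDr.
Qed.

Lemma expectZ k s c F : expect k s (fun s' => c * F s') = c * expect k s F.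
Proof.
elim: k s => //= k IH s; rewrite big_distrr; apply: eq_bigr => e _.
by rewrite IH mulrCA.
Qed.

(** Iterated conditioning. The one-step hypothesis is the bound on the mean over the available
    calls, cleared of its denominator; the bound on [size s + k] keeps that denominator positive. *)
Lemma expect_supermartingale k s (phi : seq {set 'I_n} -> R) (c : R) :
    valid s -> (size s + k <= 'C(n, 2))%N -> 0 <= c ->
    (forall s', valid s' -> (size s <= size s' < size s + k)%N ->
      \sum_(e in available s') phi (rcons s' e) <= c * phi s' * #|available s'|%:R) ->
  expect k s phi <= c ^+ k * phi s.
Proof.
elim: k s => [|k IH] s vs sk c0 step /=; first by rewrite mul1r.
have av : (0 < #|available s|)%N by rewrite card_available // subn_gt0; lia.
apply: (@le_trans _ _ (\sum_e co_step R s e * (c ^+ k * phi (rcons s e)))).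
  apply: ler_sum => e _; have [es|es] := boolP (e \in available s); last first.
    by rewrite /co_step (negPf es) !mul0r.
  apply: ler_wpM2l; first exact: co_step_ge0.
  apply: IH => //; [exact: valid_rcons | by rewrite size_rcons addSnnS |].
  move=> s' vs'; rewrite size_rcons => s's; apply: step => //; lia.
rewrite sum_co_step -big_distrr /= ler_pdivrMr ?ltr0n //.
rewrite exprSr -!mulrA; apply: ler_wpM2l; first exact: exprn_ge0.
by rewrite mulrA; apply: step => //; lia.
Qed.

Lemma expect_cst k s (c : R) :
  valid s -> (size s + k <= 'C(n, 2))%N -> expect k s (fun=> c) = c.
Proof.
elim: k s => //= k IH s vs sk.
have av : (0 < #|available s|)%N by rewrite card_available // subn_gt0; lia.
transitivity (\sum_e co_step R s e * c).
  apply: eq_bigr => e _; have [es|es] := boolP (e \in available s); last first.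
    by rewrite /co_step (negPf es) !mul0r.
  by rewrite IH ?size_rcons ?addSnnS //; apply: valid_rcons.
rewrite sum_co_step sumr_const -[c *+ _]mulr_natr mulfK //.
by rewrite pnatr_eq0 -lt0n.
Qed.

Lemma sum_tuple_cons (T : finType) k (H : k.+1.-tuple T -> R) :
  \sum_t H t = \sum_x \sum_(t : k.-tuple T) H [tuple of x :: t].
Proof.
rewrite pair_big /= (reindex (fun p : T * k.-tuple T => [tuple of p.1 :: p.2])) //=.
exists (fun t : k.+1.-tuple T => (thead t, [tuple of behead t])) => [[x t] _|t _] /=.
  by congr (_, _); apply: val_inj.
by apply: val_inj => /=; rewrite [t in RHS]tuple_eta.
Qed.

Lemma expect_tuple k s F :
  expect k s F = \sum_(t : k.-tuple {set 'I_n})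
    (\prod_(i < k) co_step R (s ++ take i t) (tnth t i)) * F (s ++ t).
Proof.
elim: k s => [|k IH] s /=.
  rewrite (big_pred1 [tuple]) => [|t]; last by apply/esym/eqP; apply: tuple0.
  by rewrite big_ord0 mul1r cats0.
rewrite sum_tuple_cons; apply: eq_bigr => e _; rewrite IH big_distrr /=.
apply: eq_bigr => t _; rewrite big_ord_recl take0 cats0 tnth0 -mulrA cat_rcons.
congr (_ * (_ * _)); apply: eq_bigr => i _.
by rewrite tnthS /= cat_rcons.
Qed.

(** The calls after the first [m] carry total conditional mass one, so an event that ignores them
    can be evaluated at time [m]. *)
Lemma co_prob_pr m (A : pred (seq {set 'I_n})) : (m <= 'C(n, 2))%N ->
  co_prob (fun s : co_seq n => A (take m s)) = pr m A.
Proof.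
move=> mN; transitivity (expect 'C(n, 2) [::] (fun s => (A (take m s))%:R : R)).
  rewrite expect_tuple /co_prob big_mkcond /=; apply: eq_bigr => s _.
  by case: (A _); rewrite ?mulr1 ?mulr0.
rewrite -{1}(subnKC mN) expect_add /pr.
have cstm s : valid s -> size s = m ->
    expect ('C(n, 2) - m) s (fun s => (A (take m s))%:R : R) = (A s)%:R.
  move=> vs sm; rewrite -[RHS](@expect_cst ('C(n, 2) - m) s) //; last by lia.
  (* Once [m] calls are made, further calls leave the prefix alone, so the integrand is constant
     along every continuation. *)
  have : forall k s', take m s' = s ->
     expect k s' (fun s => (A (take m s))%:R : R) = expect k s' (fun=> (A s)%:R : R).
    elim=> [|k IH] s' ts' /=; first by rewrite ts'.
    apply: eq_bigr => e _; rewrite IH // -cats1 take_cat.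
    have : size (take m s') = m by rewrite ts'.
    rewrite size_take; case: ltnP => [ms _|ms se]; first by [].
    by rewrite -se subnn take0 cats0 -ts' take_oversize.
  by apply; rewrite -sm take_size.
by apply/eqP; rewrite eq_le; apply/andP; split; apply: expect_le => // s vs /= sm;
  rewrite cstm.
Qed.

(** Reversing the first [m] calls is an involution that only permutes the sequence, and by
    [co_massE] the mass is invariant under permutations. *)
Lemma co_prob_rev m (A : pred (seq {set 'I_n})) :
  co_prob (fun s : co_seq n => A (rev (take m s)))
  = co_prob (fun s : co_seq n => A (take m s)) :> R.
Proof.
have sz (s : co_seq n) : size (rev (take m s) ++ drop m s) == 'C(n, 2).
  by rewrite size_cat size_rev -size_cat cat_take_drop size_tuple.
pose f (s : co_seq n) : co_seq n := Tuple (sz s).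
have tf (s : co_seq n) : take m (f s) = rev (take m s).
  rewrite /= take_cat size_rev size_take; case: (ltnP m (size s)) => ms.
    by rewrite ltnn subnn take0 cats0.
  rewrite ltnNge ms /= drop_oversize //= cats0.
  by rewrite /= !(take_oversize ms).
have df (s : co_seq n) : drop m (f s) = drop m s.
  rewrite /= drop_cat size_rev size_take; case: (ltnP m (size s)) => ms.
    by rewrite ltnn subnn drop0.
  by rewrite ltnNge ms /= (drop_oversize ms).
have fK : involutive f.
  move=> s; apply: val_inj; rewrite -[RHS](cat_take_drop m).
  by change (rev (take m (f s)) ++ drop m (f s) = take m s ++ drop m s); rewrite tf df revK.
rewrite /co_prob [RHS](reindex_inj (inv_inj fK)) /=.
apply: eq_big => s; first by rewrite -[rev _ ++ _]/(val (f s)) tf.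
move=> _; rewrite !co_massE; have ps : perm_eq (f s) s.
  by rewrite -[X in perm_eq _ X](cat_take_drop m s) perm_cat2r perm_rev.
by rewrite (perm_uniq ps) (perm_all _ ps).
Qed.

Lemma pr_le m (A B : pred (seq {set 'I_n})) :
  (forall s, valid s -> size s = m -> A s -> B s) -> pr m A <= pr m B.
Proof.
move=> AB; apply: expect_le => // s vs /= sm; rewrite ler_nat.
by have := AB s vs sm; case: (A s) => // ->.
Qed.

Lemma pr_or m (A B : pred (seq {set 'I_n})) :
  pr m (fun s => A s || B s) <= pr m A + pr m B.
Proof.
rewrite /pr -expectD; apply: expect_le => // s _ _.
by rewrite -natrD ler_nat; case: (A s); case: (B s).
Qed.

Lemma pr_exists m (I : finType) (A : I -> pred (seq {set 'I_n})) :
  pr m (fun s => [exists i, A i s]) <= \sum_i pr m (A i).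
Proof.
rewrite /pr -expect_sum; apply: expect_le => // s _ _.
case: existsP => [[i Ai]|_]; last by apply: sumr_ge0 => i _; rewrite ler0n.
by rewrite (bigD1 i) //= Ai lerDl sumr_ge0.
Qed.

End Expectation.

(** * How one secret spreads, time reversal, and sums over pairs of agents *)

Section Spread.
Variable n : nat.
Implicit Types (s : seq {set 'I_n}) (e X : {set 'I_n}) (a b u v x y : 'I_n).

Definition spread a s : {set 'I_n} := [set y | a \in knowledge_after s y]%SET.

Definition uncalled s : {set 'I_n} := [set v | all (fun e => v \notin e) s]%SET.

Definition nbrs s v : {set 'I_n} := [set y | [set v; y]%SET \in s]%SET.

Lemma spread_nil a : spread a [::] = [set a]%SET.
Proof. by apply/setP => y; rewrite !inE ffunE inE eq_sym. Qed.

Lemma spread_rcons a s e : spread a (rcons s e) =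
  if [disjoint e & spread a s] then spread a s else (e :|: spread a s)%SET.
Proof.
have E y : (y \in spread a (rcons s e)) =
    if y \in e then [exists x in e, x \in spread a s] else y \in spread a s.
  rewrite inE /knowledge_after foldl_rcons ffunE; case: ifP => _; last by rewrite inE.
  by apply/bigcupP/exists_inP => -[x xe ax]; exists x => //; move: ax; rewrite inE.
apply/setP => y; rewrite E; have [dis|] := boolP [disjoint _ & _].
  case: ifPn => // ye; rewrite (disjointFr dis ye).
  by apply/exists_inP => -[x xe]; rewrite (disjointFr dis xe).
rewrite -setI_eq0 => /set0Pn[x]; rewrite in_setI => /andP[xe xs].
rewrite in_setU; case: ifP => //= ye.
by apply/exists_inP; exists x.
Qed.

Lemma spread_self a s : a \in spread a s.
Proof.
elim/last_ind: s => [|s e IH]; first by rewrite spread_nil set11.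
by rewrite spread_rcons; case: ifP => // _; rewrite in_setU IH orbT.
Qed.

Lemma uncalled_rcons s e : uncalled (rcons s e) = (uncalled s :\: e)%SET.
Proof. by apply/setP => v; rewrite !inE all_rcons. Qed.

Lemma spread_uncalled u s : u \in uncalled s -> spread u s = [set u]%SET.
Proof.
elim/last_ind: s => [|s e IH]; first by rewrite spread_nil.
rewrite uncalled_rcons inE => /andP[ue /IH us].
by rewrite spread_rcons us disjoint_sym disjoints1 ue.
Qed.

(** Calls only take unions, so whose initial knowledge reaches [a] does not depend on [K]. This is
    what allows a call to be put in front of a sequence. *)
Lemma foldl_make_callE s (K : knowledge n) a :
  foldl (@make_call n) K s a = (\bigcup_(c in knowledge_after s a) K c)%SET.
Proof.
elim/last_ind: s a => [|s e IH] a.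
  by rewrite /= ffunE big_set1.
rewrite /knowledge_after !foldl_rcons !ffunE; case: ifP => _; last exact: IH.
apply/setP => y; apply/bigcupP/bigcupP => [[c ce]|[c /bigcupP[d de cd] yc]].
  rewrite IH => /bigcupP[d dc yd]; exists d => //.
  by apply/bigcupP; exists c.
by exists d => //; rewrite IH; apply/bigcupP; exists c.
Qed.

(** A secret travels along a chain of calls with increasing times; reversing time turns the chains
    that lead to [a] into those that start at [a]. In the induction, a call put in front of [s]
    becomes the last call of [rev s]. *)
Lemma spread_rev a s : spread a (rev s) = knowledge_after s a.
Proof.
elim: s => [|e s IH].
  by apply/setP => y; rewrite inE !ffunE !inE eq_sym.
rewrite rev_cons spread_rcons IH.
have -> : knowledge_after (e :: s) a =
    (\bigcup_(c in knowledge_after s a) make_call (init_knowledge n) e c)%SET.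
  by rewrite -foldl_make_callE.
apply/setP => y; apply/idP/bigcupP.
  case: ifPn => [dis ya|].
    exists y => //; rewrite ffunE (disjointFl dis ya) ffunE; exact: set11.
  rewrite -setI_eq0 => /set0Pn[x]; rewrite in_setI => /andP[xe xs].
  rewrite in_setU => yes; have [ye|ye] := boolP (y \in e).
    exists x => //; rewrite ffunE xe; apply/bigcupP; exists y => //.
    by rewrite ffunE set11.
  exists y; first by move: yes; rewrite (negPf ye).
  by rewrite ffunE (negPf ye) ffunE set11.
move=> [c ca]; rewrite ffunE; case: ifPn => ce.
  move=> /bigcupP[d de]; rewrite ffunE inE => /eqP->.
  case: ifPn => [dis|_]; last by rewrite inE de.
  by move: (disjointFr dis ce); rewrite ca.
rewrite ffunE inE => /eqP->; case: ifP => // _.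
by rewrite inE ca orbT.
Qed.

Lemma card_nbrs_rcons s e v : e \in pairs n ->
  (#|nbrs (rcons s e) v| <= #|nbrs s v| + (v \in e))%N.
Proof.
move=> ep; have /cards2P[x [y [xy ->]]] : #|e| == 2 by move: ep; rewrite inE.
have [ve|ve] := boolP (v \in _); last first.
  rewrite addn0; apply/subset_leq_card/subsetP => z; rewrite !inE mem_rcons inE.
  by case/orP => // /eqP E; rewrite -E set21 in ve.
wlog -> : x y xy ve / v = x.
  move: (ve); rewrite !inE => /orP[/eqP vx|/eqP vy] W; first exact: W.
  rewrite [in X in (X <= _)%N]setUC; apply: W; rewrite 1?eq_sym // setUC //.
apply: (@leq_trans #|y |: nbrs s x|%SET); last by rewrite cardsU1 addnC; lia.
apply/subset_leq_card/subsetP => z; rewrite !inE mem_rcons inE.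
case/orP => [/eqP E|->]; last by rewrite orbT.
have : z \in [set x; y]%SET by rewrite -E set22.
have : y \in [set x; z]%SET by rewrite E set22.
rewrite !inE (eq_sym y x) (negPf xy) /= => /eqP->.
by rewrite eqxx.
Qed.

Lemma nbrs_sub_rcons s e v : nbrs s v \subset nbrs (rcons s e) v.
Proof. by apply/subsetP => y; rewrite !inE mem_rcons inE => ->; rewrite orbT. Qed.

Variable R : realType.

(** Every other pair has exactly one endpoint on each side of [X], and these two endpoints determine
    it. *)
Lemma sum_cross_pairs X (G : {set 'I_n} -> R) :
    (forall e, e \in pairs n -> (e \subset X) || [disjoint e & X] -> G e = 0) ->
  \sum_(e in pairs n) G e = \sum_(x in X) \sum_(y in ~: X) G [set x; y]%SET.
Proof.
move=> G0; rewrite pair_big_dep /=.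
pose P := [set p : 'I_n * 'I_n | (p.1 \in X) && (p.2 \in ~: X)]%SET.
pose h (p : 'I_n * 'I_n) := [set p.1; p.2]%SET.
have hX p : p \in P -> (h p :&: X)%SET = [set p.1]%SET /\ (h p :\: X)%SET = [set p.2]%SET.
  rewrite !inE => /andP[p1 p2]; split; apply/setP => z; rewrite !inE.
    have [->|z1] := eqVneq z p.1; first by rewrite p1.
    by have [->|z2] := eqVneq z p.2; rewrite // (negPf p2).
  have [->|z1] := eqVneq z p.2; first by rewrite p2 orbT.
  by have [->|z2] := eqVneq z p.1; rewrite ?p1 // andbF.
have hinj : {in P &, injective h}.
  move=> [x y] [x' y'] p p' E; have [E1 E2] := hX _ p; have [F1 F2] := hX _ p'.
  move: E1; rewrite E F1 => /set1_inj /= ->.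
  by move: E2; rewrite E F2 => /set1_inj /= ->.
transitivity (\sum_(e in (h @: P)%SET) G e); last first.
  rewrite big_imset //=; apply: eq_big => [p|//]; by rewrite !inE.
rewrite (bigID (mem (h @: P)%SET)) /= [X in _ + X]big1 ?addr0.
  apply: eq_bigl => e; rewrite andb_idl // => /imsetP[[x y]].
  rewrite !inE /= => /andP[xX yX] ->; rewrite cards2.
  by have [xy|//] := eqVneq x y; rewrite xy (negPf yX) in xX.
move=> e /andP[ep eh]; apply: G0 => //; apply: contraR eh; rewrite negb_or.
case/andP=> /subsetPn[y ye yX]; rewrite -setI_eq0 => /set0Pn[x].
rewrite inE => /andP[xe xX]; apply/imsetP; exists (x, y); first by rewrite !inE xX yX.
apply/esym/eqP; rewrite eqEcard /h /=; move: ep; rewrite inE => /eqP->.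
rewrite subUset !sub1set xe ye cards2.
by have [xy|//] := eqVneq x y; rewrite xy (negPf yX) in xX.
Qed.

Lemma sum_star_pairs x (G : {set 'I_n} -> R) :
  \sum_(e in pairs n | x \in e) G e = \sum_(y | y != x) G [set x; y]%SET.
Proof.
rewrite big_mkcondr (@sum_cross_pairs [set x]%SET).
  rewrite big_set1; apply: eq_big => [y|y _]; first by rewrite !inE.
  by rewrite set21.
move=> e ep /orP[ex|]; last by rewrite disjoint_sym disjoints1 => /negPf->.
have := subset_leq_card ex; rewrite cards1.
by move: ep; rewrite inE => /eqP->.
Qed.

(** Only a fresh call across the boundary of the spread changes it, and it adds just the outer
    endpoint. This is the total one-step drift of any potential that depends on the spread alone. *)
Lemma sum_available_spread a s (Phi : {set 'I_n} -> R) :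
  \sum_(e in available s) (Phi (spread a (rcons s e)) - Phi (spread a s)) =
  \sum_(x in spread a s) \sum_(y in ~: spread a s)
    (if [set x; y]%SET \in s then 0 else Phi (y |: spread a s)%SET - Phi (spread a s)).
Proof.
transitivity (\sum_(e in pairs n) if e \in s then 0 else
    Phi (spread a (rcons s e)) - Phi (spread a s)).
  under eq_bigl do rewrite inE.
  by rewrite big_mkcondr; apply: eq_bigr => e _; rewrite if_neg.
rewrite (@sum_cross_pairs (spread a s)).
  apply: eq_bigr => x xX; apply: eq_bigr => y _; case: ifP => // _.
  rewrite spread_rcons -setI_eq0; case: ifPn => [/eqP/setP/(_ x)|_].
    by rewrite in_set0 in_setI set21 xX.
  congr (Phi _ - _); rewrite -setUA [RHS]/=; apply/setUidPr.
  by rewrite sub1set in_setU xX orbT.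
move=> e _; rewrite spread_rcons; case: ifP => // _ /orP[|->]; last by rewrite subrr.
by move/setUidPr=> ->; rewrite if_same subrr.
Qed.

End Spread.

(** * Bounds for fixed [n]: informing one agent, uncalled agents, degrees *)

Section FiniteBounds.
Variables (n : nat) (R : realType).
Implicit Types (s : seq {set 'I_n}) (e X : {set 'I_n}) (a b u v x y : 'I_n).

(** Factor per call when the increments of a potential over the available calls sum to at most [r]
    times its value: before time [m], more than ['C(n, 2) - m] calls are available. *)
Definition growth (r : R) (m : nat) : R := 1 + r / ('C(n, 2) - m)%:R.

Lemma growth_ge0 r m : 0 <= r -> 0 <= growth r m.
Proof. by move=> r0; rewrite addr_ge0 // mulr_ge0 // invr_ge0 ler0n. Qed.

Lemma expect_growth k s m (phi : seq {set 'I_n} -> R) (r : R) :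
    valid s -> (size s + k = m)%N -> (m < 'C(n, 2))%N -> 0 <= r ->
    (forall s', valid s' -> (size s <= size s' < m)%N -> 0 <= phi s' /\
      \sum_(e in available s') (phi (rcons s' e) - phi s') <= r * phi s') ->
  expect k s phi <= growth r m ^+ k * phi s.
Proof.
move=> vs skm mN r0 step; apply: expect_supermartingale => //; first by lia.
  exact: growth_ge0.
move=> s' vs' s's; have [|phi0] := step s' vs'; first by lia.
have N0 : 0 < ('C(n, 2) - m)%:R :> R by rewrite ltr0n subn_gt0.
rewrite big_split /= sumr_const -[(- _) *+ _]mulr_natr mulNr lerBlDr => /le_trans; apply.
have -> : growth r m * phi s' * #|available s'|%:R =
    r * phi s' * (#|available s'|%:R / ('C(n, 2) - m)%:R) + phi s' * #|available s'|%:R.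
  by rewrite /growth; field; exact: lt0r_neq0.
rewrite lerD2r; apply: ler_peMr; first exact: mulr_ge0.
by rewrite ler_pdivlMr // mul1r ler_nat card_available //; lia.
Qed.

Lemma pr_markov m (A : pred (seq {set 'I_n})) (phi : seq {set 'I_n} -> R) (c : R) :
    (forall s, valid s -> size s = m -> 0 <= phi s) ->
    (forall s, valid s -> size s = m -> A s -> c <= phi s) ->
  c * pr R m A <= expect m [::] phi.
Proof.
move=> phi0 cphi; rewrite /pr -expectZ; apply: expect_le => // s vs sm.
by have := cphi s vs sm; case: (A s) => [/(_ isT)|_]; rewrite ?mulr1 // mulr0 phi0.
Qed.

(** The indicator of [b \in X] rises at rate up to [#|X|], which it does not control itself; hence
    [#|X|], whose own rate is at most [n%:R] times itself, joins the potential. The initial value is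
    1 because [b] is not [a]. *)
Lemma pr_informed a b m (eps : R) : 0 < eps -> a != b -> (m < 'C(n, 2))%N ->
  eps * n%:R * pr R m (fun s => b \in spread a s)
  <= growth ((1 + eps) * n%:R) m ^+ m.
Proof.
move=> eps0 ab mN.
pose Phi X : R := eps * n%:R * (b \in X)%:R + #|X|%:R.
have en0 : 0 <= eps * n%:R :> R by rewrite mulr_ge0 // ltW.
have Phi0 X : 0 <= Phi X by rewrite addr_ge0 // mulr_ge0.
apply: (@le_trans _ _ (expect m [::] (fun s => Phi (spread a s)))).
  by apply: pr_markov => // s _ _ bs; rewrite /Phi bs mulr1 lerDl.
have -> : growth ((1 + eps) * n%:R) m ^+ m =
    growth ((1 + eps) * n%:R) m ^+ m * Phi (spread a [::]).
  by rewrite /Phi spread_nil in_set1 eq_sym (negPf ab) mulr0 add0r cards1 mulr1.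
apply: expect_growth => // [|s vs _]; first by rewrite mulr_ge0 // addr_ge0 // ltW.
split=> //; rewrite sum_available_spread; set X := spread a s.
apply: (@le_trans _ _ (\sum_(x in X) (1 + eps) * n%:R)); last first.
  rewrite sumr_const -[leLHS]mulr_natr; apply: ler_wpM2l.
    by rewrite mulr_ge0 // addr_ge0 // ltW.
  by rewrite /Phi lerDr mulr_ge0.
apply: ler_sum => x _.
(* The budget of each [x] is split over the partners [y]: 1 for the growth of [X], and the weight of
   the indicator at [b]. *)
have -> : (1 + eps) * n%:R = \sum_y (1 + eps * n%:R * (y == b)%:R) :> R.
  rewrite big_split /= sumr_const card_ord (bigD1 b) //= eqxx big1 ?addr0 ?mulr1 ?mulrDl ?mul1r //.
  by move=> y /negPf->; rewrite mulr0.
rewrite [leRHS](bigID (mem (~: X)%SET)) /= ler_wpDr //.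
  by apply: sumr_ge0 => y _; rewrite addr_ge0 // mulr_ge0.
apply: ler_sum => y; rewrite in_setC => yX.
case: ifP => _; first by rewrite addr_ge0 // mulr_ge0.
rewrite /Phi cardsU1 yX in_setU1 natrD (eq_sym b y).
have [<-|yb] := eqVneq y b; first by rewrite (negPf yX) /= !mulr1 mulr0; lra.
by rewrite /= mulr0; lra.
Qed.

Lemma pr_no_uncalled m : (m < 'C(n, 2))%N ->
  pr R m (fun s => uncalled s == set0) <= growth n%:R m ^+ m / n%:R.
Proof.
move=> mN; have n0 : (0 < n)%N by case: n mN.
pose phi s : R := (#|uncalled s|.+1)%:R^-1.
have phi0 s : 0 <= phi s by rewrite invr_ge0.
rewrite -[leLHS]mul1r; apply: (@le_trans _ _ (expect m [::] phi)).
  by apply: pr_markov => // s _ _ /eqP I0; rewrite /phi I0 cards0 invr1.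
apply: (@le_trans _ _ (growth n%:R m ^+ m * phi [::])); last first.
  apply: ler_wpM2l; first by rewrite exprn_ge0 // growth_ge0.
  rewrite /phi (_ : uncalled [::] = setT) ?cardsT ?card_ord.
    by rewrite lef_pV2 ?posrE ?ltr0n // ler_nat.
  by apply/setP => v; rewrite !inE.
apply: expect_growth => // s vs _; split=> //.
set I := uncalled s.
(* Share of the increase of [phi] charged to each endpoint of [e] in [I]: losing one agent raises
   [phi] by [phi s / #|I|], losing two by [2 * phi s / (#|I| - 1)]. *)
pose c e : R := phi s * (if e \subset I then #|I|.-1%:R^-1 else #|I|%:R^-1).
have c0 e : 0 <= c e by rewrite /c; case: ifP => _; rewrite mulr_ge0 ?invr_ge0.
have Sc0 e : 0 <= \sum_(x in I | x \in e) c e by apply: sumr_ge0.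
apply: (@le_trans _ _ (\sum_(e in pairs n) \sum_(x in I | x \in e) c e)).
  under [leLHS]eq_bigl do rewrite inE.
  rewrite big_mkcondr; apply: ler_sum => e ep; case: ifP => // _.
  have -> : \sum_(x in I | x \in e) c e = #|(I :&: e)%SET|%:R * c e.
    rewrite (eq_bigl (mem (I :&: e)%SET)); last by move=> x; rewrite /= in_setI.
    by rewrite sumr_const mulr_natl.
  rewrite {1}/phi uncalled_rcons -/I.
  have cI : (#|I| = #|(I :&: e)%SET| + #|(I :\: e)%SET|)%N by rewrite cardsID.
  have e2 : #|e| = 2%N by move: ep; rewrite inE => /eqP.
  have le2 : (#|(I :&: e)%SET| <= 2)%N by rewrite -e2 subset_leq_card // subsetIr.
  have eI : (e \subset I) = (#|(I :&: e)%SET| == 2)%N.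
    rewrite -e2; apply/idP/eqP => [/setIidPr->//|E].
    by apply/setIidPr/eqP; rewrite eqEcard subsetIr E leqnn.
  rewrite /c eI /phi -/I; move: cI le2; move: #|(I :&: e)%SET| #|(I :\: e)%SET|.
  move=> j i ->; case: j => [|[|[|//]]] _ /=.
  - by rewrite mul0r addrN.
  - rewrite mul1r add1n le_eqVlt; apply/orP; left; apply/eqP.
    have i0 : 0 <= i%:R :> R by [].
    rewrite -!natr1; field; apply/andP; split; apply: lt0r_neq0; lra.
  rewrite le_eqVlt; apply/orP; left; apply/eqP.
  have i0 : 0 <= i%:R :> R by [].
  rewrite -!natr1; field; apply/andP; split; apply: lt0r_neq0; lra.
rewrite (exchange_big_dep (mem I)) /=; last by move=> e x _ /andP[].
have -> : \sum_(x in I) \sum_(e in pairs n | (x \in I) && (x \in e)) c e =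
    \sum_(x in I) \sum_(y | y != x) c [set x; y]%SET.
  apply: eq_bigr => x xI; rewrite -sum_star_pairs.
  by apply: eq_bigl => e; rewrite xI.
(* The partners of [x] inside [I] contribute at most [phi s] in all, those outside [phi s / #|I|]
   each. The total is [n * phi s / #|I|], so summing over [I] gives [n * phi s]. *)
have sumx x : x \in I -> \sum_(y | y != x) c [set x; y]%SET <=
   phi s * (1 + (n%:R - #|I|%:R) / #|I|%:R).
  move=> xI; rewrite (bigID (mem I)) /= mulrDr; apply: lerD.
    rewrite (eq_bigr (fun=> phi s / #|I|.-1%:R)); last first.
      by move=> y /andP[_ yI]; rewrite /c subUset !sub1set xI yI.
    rewrite (eq_bigl (mem (I :\ x)%SET)); last by move=> y; rewrite /= in_setD1.
    rewrite sumr_const (cardsD1 x I) xI /= -[leLHS]mulr_natr -mulrA.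
    apply: ler_wpM2l => //; have [->|k0] := eqVneq (#|(I :\ x)%SET|)%:R (0 : R).
      by rewrite mulr0.
    by rewrite mulVf.
  rewrite (eq_bigr (fun=> phi s / #|I|%:R)); last first.
    by move=> y /andP[_ yI]; rewrite /c subUset !sub1set xI (negPf yI).
  rewrite (eq_bigl (mem (~: I)%SET)); last first.
    move=> y; rewrite /= in_setC andb_idl //; apply: contraNneq => -> //.
  rewrite sumr_const -[leLHS]mulr_natr -mulrA; apply: ler_wpM2l => //.
  rewrite mulrC; apply: ler_wpM2r; first by rewrite invr_ge0.
  by have /(congr1 (fun k => k%:R : R)) := cardsC I; rewrite card_ord natrD; lra.
apply: le_trans (ler_sum _ sumx) _; rewrite sumr_const -[leLHS]mulr_natr.
have [->|I0] := eqVneq (#|I|%:R : R) 0; first by rewrite mulr0 mulr_ge0.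
rewrite le_eqVlt; apply/orP; left; apply/eqP; field; exact: I0.
Qed.

(** The potential [2 ^+ #|nbrs s v|] at most doubles at a call of [v], and at most [n] pairs contain
    [v]. *)
Lemma pr_degree v D m : (m < 'C(n, 2))%N ->
  pr R m (fun s => D <= #|nbrs s v|)%N <= growth n%:R m ^+ m / 2 ^+ D.
Proof.
move=> mN; rewrite ler_pdivlMr ?exprn_gt0 // mulrC.
pose phi s : R := 2 ^+ #|nbrs s v|.
have phi0 s : 0 <= phi s by rewrite exprn_ge0.
apply: (@le_trans _ _ (expect m [::] phi)).
  by apply: pr_markov => // s _ _ /= Ds; rewrite /phi ler_weXn2l // ler1n.
have phi1 : phi [::] = 1.
  have -> : phi [::] = 2 ^+ #|(set0 : {set 'I_n})|; last by rewrite cards0.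
  by congr (_ ^+ #|pred_of_set _|); apply/setP => y; rewrite !inE.
rewrite -[leRHS]mulr1 -[X in _ <= _ * X]phi1.
apply: expect_growth => // s vs _; split=> //.
apply: (@le_trans _ _ (\sum_(e in pairs n | v \in e) phi s)).
  under [leLHS]eq_bigl do rewrite inE.
  rewrite big_mkcondr [leRHS]big_mkcondr; apply: ler_sum => e ep.
  have nd := card_nbrs_rcons s v ep.
  case: (e \notin s); last by case: ifP.
  move: nd; case: (v \in e) => nd; rewrite lerBlDr.
    have -> : phi s + phi s = 2 ^+ (#|nbrs s v| + 1) by rewrite /phi exprD expr1; ring.
    by rewrite /phi ler_weXn2l // ler1n.
  by rewrite add0r /phi ler_weXn2l ?ler1n // -[#|nbrs s v|]addn0.
rewrite sum_star_pairs sumr_const -[leLHS]mulr_natl ler_wpM2r // ler_nat.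
by rewrite -[leqRHS]card_ord max_card.
Qed.

End FiniteBounds.

Lemma leq_subn1_bin2 n : (n - 1 <= 'C(n, 2))%N.
Proof. by case: n => // n; rewrite subn1 binS bin1 leq_addl. Qed.

(** * Bounds for fixed [n]: reaching all agents, and failing to reach one *)

Section Completion.
Variables (n : nat) (R : realType).
Implicit Types (s : seq {set 'I_n}) (e X : {set 'I_n}) (a b u v x y : 'I_n).

(** A discrete form of the [k]-th power of [x / (n - x)], the quantity that grows exponentially
    under the logistic equation. The shifts make the relative increment times [x * (n - x)] equal to
    [k * (n + k)] for every [x], by [logisticS]. *)
Definition logistic (k x : nat) : R :=
  \prod_(i < k) ((x + i)%:R / (n - x + i).+1%:R).

Lemma logistic_ge0 (k x : nat) : 0 <= logistic k x.
Proof. by apply: prodr_ge0 => i _; rewrite mulr_ge0 // invr_ge0. Qed.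

Lemma logisticS (k x : nat) : (x < n)%N ->
  logistic k x.+1 * (x%:R * (n - x)%:R) =
  logistic k x * ((x + k)%:R * (n - x + k)%:R).
Proof.
move=> xn; elim: k => [|k IH]; first by rewrite /logistic !big_ord0 !addn0.
rewrite /logistic !big_ord_recr /= -!/(logistic _ _).
have -> : ((n - x.+1 + k).+1 = n - x + k)%N by lia.
have nz : (n - x + k)%:R != 0 :> R by rewrite pnatr_eq0; lia.
have nz1 : (n - x + k).+1%:R != 0 :> R by rewrite pnatr_eq0.
rewrite mulrAC IH !addnS !addSn.
move: nz nz1; move: (logistic k x) (n - x + k)%:R (n - x + k).+1%:R => L p q p0 q0.
by move: (x + k)%:R (x + k).+1%:R => r r'; field; rewrite p0 q0.
Qed.

Lemma logistic1 k : (0 < n)%N -> logistic k 1 <= (k%:R / n%:R) ^+ k.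
Proof.
move=> n0; rewrite -[k in X in _ <= _ ^+ X]card_ord -prodr_const; apply: ler_prod => i _.
rewrite mulr_ge0 ?invr_ge0 //= ler_pdivrMr ?ltr0n // mulrAC ler_pdivlMr ?ltr0n //.
rewrite -!natrM ler_nat; have := ltn_ord i; nia.
Qed.

Lemma logisticn k : (0 < n)%N -> logistic k n * logistic k 1 = 1.
Proof.
move=> n0; rewrite /logistic -big_split /= big1 // => i _.
rewrite subnn add0n add1n.
have -> : (n - 1 + i).+1 = (n + i)%N by lia.
by rewrite -[X in _ * X]invf_div divff //; apply: mulf_neq0; rewrite ?invr_eq0 pnatr_eq0; lia.
Qed.

(** If [u] is uncalled at time [t], its secret is still at one agent, so [logistic] must climb from
    [logistic k 1] to [logistic k n], its inverse, in [m - t] calls. This gives the square in the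
    bound. *)
Lemma pr_uncalled_then_all u k t m : (t <= m)%N -> (m < 'C(n, 2))%N ->
  pr R m (fun s => (u \in uncalled (take t s)) && (spread u s == setT))
  <= ((k%:R / n%:R) ^+ k) ^+ 2 * growth n (k%:R * (n + k)%:R) m ^+ (m - t).
Proof.
move=> tm mN; have n0 : (0 < n)%N by case: n mN.
pose phi s : R := (u \in uncalled (take t s))%:R * logistic k #|spread u s|.
have phi0 s : 0 <= phi s by apply: mulr_ge0; [exact: ler0n | exact: logistic_ge0].
set c := growth _ _ _; have c0 : 0 <= c by rewrite growth_ge0 // mulr_ge0.
apply: (@le_trans _ _ (logistic k 1 ^+ 2 * c ^+ (m - t))); last first.
  apply: ler_wpM2r; first exact: exprn_ge0.
  by apply: lerXn2r; rewrite ?nnegrE ?logistic_ge0 ?logistic1 // exprn_ge0 // mulr_ge0 // invr_ge0.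
have h1 : 0 < logistic k 1.
  rewrite lt_neqAle logistic_ge0 andbT eq_sym; apply/eqP => E.
  by have /eqP := logisticn k n0; rewrite E mulr0 eq_sym oner_eq0.
rewrite expr2 -mulrA mulrC -ler_pdivrMr // mulrC.
have -> : (logistic k 1)^-1 = logistic k n.
  by rewrite -[RHS](mulfK (lt0r_neq0 h1)) logisticn // mul1r.
apply: (@le_trans _ _ (expect m [::] phi)).
  apply: pr_markov => // s _ _ /andP[us /eqP sT].
  by rewrite /phi us sT cardsT card_ord mul1r.
rewrite -{1}(subnKC tm) expect_add.
have tN : (size ([::] : seq {set 'I_n}) + t <= 'C(n, 2))%N by rewrite add0n; lia.
rewrite -[leRHS](@expect_cst n R t [::]) //; apply: expect_le => // s vs /=; rewrite add0n => st.
apply: (@le_trans _ _ (c ^+ (m - t) * phi s)); last first.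
  rewrite mulrC; apply: ler_wpM2r; first exact: exprn_ge0.
  rewrite /phi; have [|] := boolP (u \in _); last by rewrite mul0r ltW.
  by rewrite -st take_size => /spread_uncalled->; rewrite cards1 mul1r.
apply: expect_growth => //; first by lia.
  by rewrite mulr_ge0.
(* After time [t] the factor about [take t] is frozen, and only [logistic] drifts. *)
move=> s' vs' ss'; split=> //.
have takeE e : take t (rcons s' e) = take t s'.
  by rewrite -cats1 takel_cat //; lia.
under eq_bigr do rewrite /phi takeE -mulrBr.
rewrite -big_distrr /= mulrCA; apply: ler_wpM2l => //.
rewrite (sum_available_spread _ _ (fun X => logistic k #|X|)).
set X := spread u s'; have X0 : (0 < #|X|)%N.
  by rewrite card_gt0; apply/set0Pn; exists u; apply: spread_self.
pose d : R := logistic k #|X|.+1 - logistic k #|X|.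
have dE : (#|X| < n)%N -> d * (#|X|%:R * (n - #|X|)%:R) = k%:R * (n + k)%:R * logistic k #|X|.
  move=> Xn; rewrite mulrBl logisticS // !natrD natrB; last exact: ltnW.
  by ring.
apply: (@le_trans _ _ (\sum_(x in X) \sum_(y in ~: X) d)); last first.
  rewrite !sumr_const; have -> : #|(~: X)%SET| = (n - #|X|)%N.
    by have := cardsC X; rewrite card_ord; lia.
  rewrite -mulrnA -[leLHS]mulr_natr mulnC natrM.
  have [Xn|Xn] := ltnP #|X| n; first by rewrite dE.
  by rewrite (eqP (_ : n - #|X| == 0)%N) ?subn_eq0 // mulr0 mulr0 !mulr_ge0 // logistic_ge0.
apply: ler_sum => x _; apply: ler_sum => y; rewrite in_setC => yX.
rewrite cardsU1 yX add1n; case: ifP => // _.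
have Xn : (#|X| < n)%N.
  rewrite -[ltnRHS]card_ord -cardsT; apply: proper_card.
  by apply/properP; split; [apply: subsetT|exists y => //; rewrite in_setT].
(* Used pairs contribute 0 instead of [d], which is harmless as [d] is nonnegative. *)
have : 0 <= d * (#|X|%:R * (n - #|X|)%:R) by rewrite dE // !mulr_ge0 // logistic_ge0.
by rewrite pmulr_lge0 // -natrM ltr0n muln_gt0 X0 subn_gt0.
Qed.

Definition low_degree D s := [forall v, #|nbrs s v| <= D]%N.

Lemma pr_high_degree D m : (m < 'C(n, 2))%N ->
  pr R m (fun s => ~~ low_degree D s) <= n%:R * growth n n%:R m ^+ m / 2 ^+ D.
Proof.
move=> mN; apply: (@le_trans _ _ (pr R m (fun s => [exists v, D <= #|nbrs s v|]%N))).
  apply: pr_le => s _ _; rewrite negb_forall => /existsP[v vD].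
  by apply/existsP; exists v; rewrite ltnW // ltnNge.
apply: le_trans (pr_exists _ _ _) _.
apply: le_trans (ler_sum _ (fun v _ => pr_degree R v D mN)) _.
by rewrite sumr_const card_ord -[leLHS]mulr_natl mulrA.
Qed.

(** The inverse of [x - 1] would be infinite at the start [x = 1]; the cap [eps^-1] costs only the
    factor [1 - eps] in the relative decrease [1 / x] of [missS]. *)
Definition miss (eps : R) (x : nat) : R := if (x <= 1)%N then eps^-1 else x.-1%:R^-1.

Lemma miss_gt0 eps (x : nat) : 0 < eps -> 0 < miss eps x.
Proof.
move=> e0; rewrite /miss; case: leqP => [_|x1]; rewrite invr_gt0 // ltr0n; lia.
Qed.

Lemma missS eps (x : nat) : 0 < eps -> eps < 1 -> (0 < x)%N ->
  miss eps x.+1 - miss eps x <= - ((1 - eps) * miss eps x / x%:R).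
Proof.
move=> e0 e1; case: x => [//|[_|x _]]; rewrite /miss /=.
  rewrite invr1 mulr1 le_eqVlt; apply/orP; left; apply/eqP; field; exact: lt0r_neq0.
have x0 : 0 <= x%:R :> R by [].
have y0 : 0 < (x%:R + 1)^-1 :> R by rewrite invr_gt0; lra.
have z0 : 0 < (x%:R + 1 + 1)^-1 :> R by rewrite invr_gt0; lra.
rewrite -!natr1; have -> : (x%:R + 1 + 1)^-1 - (x%:R + 1)^-1 =
    - ((x%:R + 1)^-1 / (x%:R + 1 + 1)) :> R.
  by field; apply/andP; split; apply: lt0r_neq0; lra.
rewrite lerN2 -mulrA; apply: ler_piMl; [by rewrite mulr_ge0 // ltW | lra].
Qed.

(** Over all crossing pairs the weights sum to exactly [n - 1]. The used ones weigh at most [2 * D]: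
    at most [D] pairs at [b] of weight 1, and at most [D] at each agent of [X] of weight
    [#|X|%:R^-1]. *)
Lemma sum_fresh_cross X s b D : X != set0 -> b \notin X -> low_degree D s ->
  n%:R - 1 - 2 * D%:R <= \sum_(x in X) \sum_(y in ~: X)
     (if [set x; y]%SET \in s then 0 else if y == b then 1 else #|X|%:R^-1) :> R.
Proof.
move=> X0 bX /forallP deg.
have Xp : 0 < #|X|%:R :> R by rewrite ltr0n card_gt0.
have Xi : 0 < #|X|%:R^-1 :> R by rewrite invr_gt0.
pose w y : R := if y == b then 1 else #|X|%:R^-1.
pose used x y : R := ([set x; y]%SET \in s)%:R.
have -> : \sum_(x in X) \sum_(y in ~: X)
     (if [set x; y]%SET \in s then 0 else if y == b then 1 else #|X|%:R^-1) =
   \sum_(x in X) \sum_(y in ~: X) w y - \sum_(x in X) \sum_(y in ~: X) used x y * w y.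
  rewrite -sumrB; apply: eq_bigr => x _; rewrite -sumrB; apply: eq_bigr => y _.
  by rewrite /used /w; case: (_ \in s); rewrite ?mul1r ?mul0r ?subrr ?subr0.
have -> : \sum_(x in X) \sum_(y in ~: X) w y = n%:R - 1.
  rewrite sumr_const (bigD1 b) ?in_setC //= /w eqxx.
  rewrite (eq_bigr (fun=> #|X|%:R^-1)); last by move=> y /andP[_ /negPf->].
  rewrite (eq_bigl (mem (~: X :\ b)%SET)); last by move=> y; rewrite !inE andbC.
  rewrite sumr_const -[LHS]mulr_natr -[X in 1 + X]mulr_natr.
  have /(congr1 (fun k => k%:R : R)) := cardsC X; rewrite card_ord.
  rewrite (cardsD1 b (~: X)%SET) in_setC bX !natrD /= => <-.
  move: Xp; move: #|X|%:R #|(~: X :\ b)%SET|%:R => p r p0.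
  by field; exact: lt0r_neq0.
suff : \sum_(x in X) \sum_(y in ~: X) used x y * w y <= 2 * D%:R by lra.
apply: (@le_trans _ _ (\sum_(x in X) (\sum_y used x y / #|X|%:R + used x b))).
  apply: ler_sum => x _.
  have -> : used x b = \sum_y used x y * (y == b)%:R.
    rewrite (bigD1 b) //= eqxx mulr1 big1 ?addr0 // => y /negPf->; by rewrite mulr0.
  rewrite -big_split /= [leRHS](bigID (mem (~: X)%SET)) /= ler_wpDr //.
    by apply: sumr_ge0 => y _; rewrite addr_ge0 // mulr_ge0 // ltW.
  apply: ler_sum => y _; rewrite -mulrDr; apply: ler_wpM2l => //.
  by rewrite /w; case: (y == b); rewrite /=; lra.
rewrite big_split /= [leRHS](_ : _ = D%:R + D%:R); last by ring.
have sum_used x : \sum_y used x y <= D%:R.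
  rewrite /used -natr_sum ler_nat; apply: leq_trans (deg x).
  rewrite -sum1_card [leqRHS]big_mkcond /=; apply: leq_sum => y _.
  by rewrite inE; case: (_ \in s).
apply: lerD.
  apply: (@le_trans _ _ (\sum_(x in X) D%:R / #|X|%:R)).
    apply: ler_sum => x _; rewrite -big_distrl /= ler_wpM2r //; exact: ltW.
  by rewrite sumr_const -[leLHS]mulr_natr mulfVK // lt0r_neq0.
apply: le_trans (sum_used b); rewrite [leRHS](bigID (mem X)) /= ler_wpDr ?sumr_ge0 //.
by apply: ler_sum => x _; rewrite /used setUC.
Qed.

(** A call that informs [b] cancels the potential, any other spreading call lowers it by a fraction
    at least [(1 - eps) / #|X|]; [sum_fresh_cross] adds these up. The potential starts at most at
    [eps^-1] and is at least [n%:R^-1] on the event, whence the factor [n%:R / eps]. *)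
Lemma pr_uninformed a b D m (eps : R) :
    0 < eps -> eps < 1 -> a != b -> (m <= 'C(n, 2))%N -> (D.*2 < n)%N ->
  pr R m (fun s => low_degree D s && (b \notin spread a s))
  <= n%:R / eps * (1 - (1 - eps) * (n%:R - 1 - 2 * D%:R) / 'C(n, 2)%:R) ^+ m.
Proof.
move=> e0 e1 ab mN Dn; have n2 : (1 < n)%N.
  by have := max_card (mem [set a; b]%SET); rewrite cards2 ab card_ord.
have N0 : (0 < 'C(n, 2))%N by rewrite bin_gt0.
set q := n%:R - 1 - 2 * D%:R; set c := 1 - _.
have q0 : 0 <= q.
  have : (D.*2 + 1)%:R <= n%:R :> R by rewrite ler_nat; lia.
  by rewrite natrD -muln2 natrM /q; lra.
have Nr : 0 < 'C(n, 2)%:R :> R by rewrite ltr0n.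
have c0 : 0 <= c.
  rewrite /c subr_ge0 ler_pdivrMr // mul1r.
  have : (n - 1)%:R <= 'C(n, 2)%:R :> R.
    by rewrite ler_nat leq_subn1_bin2.
  rewrite natrB; last exact: ltnW.
  have D0 : 0 <= D%:R :> R by [].
  have e1' : 0 <= 1 - eps by lra.
  have : (1 - eps) * q <= q by apply: ler_piMl => //; lra.
  rewrite {2}/q => H1 H2; lra.
pose psi X : R := (b \notin X)%:R * miss eps #|X|.
pose phi s : R := (low_degree D s)%:R * psi (spread a s).
have psi0 X : 0 <= psi X by rewrite mulr_ge0 // ltW // miss_gt0.
have phi0 s : 0 <= phi s by rewrite mulr_ge0.
have np : 0 < n%:R :> R by rewrite ltr0n; lia.
rewrite -mulrA mulrC -ler_pdivrMr // mulrC.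
apply: (@le_trans _ _ (expect m [::] phi)).
  apply: pr_markov => // s _ _ /andP[ls bs]; rewrite /phi ls /psi bs !mul1r /miss.
  case: leqP => [_|X1].
    rewrite lef_pV2 ?posrE //; apply: (@le_trans _ _ 1); first exact: ltW.
    by rewrite ler1n ltnW.
  rewrite lef_pV2 ?posrE ?ltr0n ?ler_nat; [|lia..].
  by apply: (leq_trans (leq_pred _)); rewrite -[leqRHS]card_ord max_card.
apply: (@le_trans _ _ (c ^+ m * phi [::])); last first.
  rewrite mulrC; apply: ler_wpM2r; first exact: exprn_ge0.
  rewrite /phi /psi spread_nil cards1 /miss /= -[leRHS]mul1r.
  case: (low_degree _ _); case: (b \notin _); rewrite ?mul1r ?mul0r // invr_ge0 ltW //.
apply: expect_supermartingale => // s vs _.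
set A := #|available s|%:R.
have [ls|nls] := boolP (low_degree D s); last first.
  (* Degrees never decrease, so once [low_degree] fails [phi] stays 0. *)
  rewrite big1; first by apply: mulr_ge0; [apply: mulr_ge0 | exact: ler0n].
  move=> e _; rewrite /phi; have [/forallP le|] := boolP (low_degree D _); last by rewrite mul0r.
  case/negP: nls; apply/forallP => v; apply: leq_trans (le v).
  exact/subset_leq_card/nbrs_sub_rcons.
apply: (@le_trans _ _ (\sum_(e in available s) psi (spread a (rcons s e)))).
  by apply: ler_sum => e _; rewrite /phi; case: (low_degree _ _); rewrite ?mul1r ?mul0r.
rewrite {1}/phi ls mul1r.
have sumE : \sum_(e in available s) psi (spread a (rcons s e)) =
    \sum_(e in available s) (psi (spread a (rcons s e)) - psi (spread a s))
    + psi (spread a s) * A.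
  by rewrite big_split /= !sumr_const mulNrn -[in RHS]mulr_natr addrNK.
rewrite sumE sum_available_spread; set X := spread a s.
have [bX|bX] := boolP (b \in X).
  have -> : psi X = 0 by rewrite /psi bX mul0r.
  rewrite !mul0r mulr0 mul0r addr0 big1 // => x _; rewrite big1 // => y _.
  by case: ifP => // _; rewrite /psi in_setU1 bX orbT mul0r subrr.
have X0 : X != set0 by apply/set0Pn; exists a; apply: spread_self.
have pE : psi X = miss eps #|X| by rewrite /psi bX mul1r.
have m0 : 0 < psi X by rewrite pE miss_gt0.
have Xp : 0 < #|X|%:R :> R by rewrite ltr0n card_gt0.
apply: (@le_trans _ _ (- ((1 - eps) * psi X * q) + psi X * A)); last first.
  rewrite /c; have -> : (1 - (1 - eps) * q / 'C(n, 2)%:R) * psi X * A =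
     - ((1 - eps) * psi X * q) * (A / 'C(n, 2)%:R) + psi X * A.
    by field; exact: lt0r_neq0.
  rewrite lerD2r mulNr lerN2; apply: ler_piMr.
    by apply: mulr_ge0 => //; apply: mulr_ge0; [lra | exact: ltW].
  by rewrite ler_pdivrMr // mul1r ler_nat card_available // leq_subr.
rewrite lerD2r.
apply: (@le_trans _ _ (- ((1 - eps) * psi X) * \sum_(x in X) \sum_(y in ~: X)
     (if [set x; y]%SET \in s then 0 else if y == b then 1 else #|X|%:R^-1))); last first.
  rewrite !mulNr lerN2; apply: ler_wpM2l; first by apply: mulr_ge0; [lra | exact: ltW].
  exact: sum_fresh_cross.
rewrite big_distrr /=; apply: ler_sum => x xX; rewrite big_distrr /=.
apply: ler_sum => y; rewrite in_setC => yX; case: ifP => _; first by rewrite mulr0.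
rewrite {1}/psi in_setU1 negb_or bX andbT cardsU1 yX add1n (eq_sym b y).
case: eqVneq => [_|_] /=.
  rewrite mul0r mulr1 add0r lerN2; apply: ler_piMl; [exact: ltW|lra].
by rewrite mul1r mulNr pE missS // card_gt0.
Qed.

End Completion.

From mathcomp Require Import all_classical all_reals all_analysis.
Import numFieldNormedType.Exports.
Local Open Scope classical_set_scope.
Local Open Scope ring_scope.

(** * The finite bounds for numbers of calls of order [n log n] *)

Section Asymptotics.
Variable R : realType.
Local Notation L n := (ln (n%:R : R)).

Lemma near_ln_ge (C : R) : \forall n \near \oo, C <= L n.
Proof.
apply: filterS (nbhs_infty_ger (expR C)) => n Cn.
by rewrite -ler_expR lnK // posrE (lt_le_trans (expR_gt0 C)).
Qed.

Lemma near_ln_le (eps : R) : 0 < eps -> \forall n \near \oo, L n <= eps * n%:R.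
Proof.
move=> e0; apply: filterS2 (nbhs_infty_ge 1) (near_ln_ge (2 / eps)) => n n1 Ln.
have L0 : 0 < L n by apply: lt_le_trans Ln; rewrite divr_gt0.
have := expR_ge1Dxn 1 (ltW L0); rewrite lnK ?posrE ?ltr0n // => H.
have {}H : L n * L n <= 2 * n%:R by move: H; rewrite expr2 (_ : 2`!%N = 2%N) //; lra.
rewrite mulrC -ler_pdivrMr //.
have : L n * (2 / eps) <= L n * L n by rewrite ler_pM2l.
by move: H; rewrite mulrCA; lra.
Qed.

Lemma near_exp_le (c K eta : R) : 0 < c -> 0 < eta ->
  \forall n \near \oo, K * expR (- (c * L n)) <= eta.
Proof.
move=> c0 e0; apply: filterS (near_ln_ge (K / (eta * c))) => n.
rewrite ler_pdivrMr ?mulr_gt0 // => Kn.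
rewrite expRN ler_pdivrMr ?expR_gt0 //; apply: le_trans Kn _.
rewrite mulrC -mulrA ler_pM2l //; apply: le_trans (expR_ge1Dx _); lra.
Qed.

Lemma bin2r (n : nat) : 'C(n, 2)%:R = n%:R * (n%:R - 1) / 2 :> R.
Proof.
case: n => [|n]; first by rewrite mul0r mul0r.
have /(congr1 (fun k => k%:R : R)) := mul_bin_diag n.+1 1.
by rewrite bin1 /= !natrM -natr1; lra.
Qed.

(** Since [n log n] is negligible against the square of [n], nearly all pairs remain. As in the
    lemmas below, [m] is quantified after [n], so that one threshold serves all [m]. *)
Lemma near_pairs_left (eps C : R) : 0 < eps -> eps < 1 -> 0 <= C ->
  \forall n \near \oo, forall m, m%:R <= C * n%:R * L n ->
    (m < 'C(n, 2))%N /\ (1 - eps) * n%:R ^+ 2 / 2 <= ('C(n, 2) - m)%:R.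
Proof.
move=> e0 e1 C0; have d0 : 0 < eps / (4 * (C + 1)) by rewrite divr_gt0 //; lra.
apply: filterS2 (near_ln_le d0) (nbhs_infty_ger (2 / eps)) => n Ln n2 m mn.
have n0 : 0 < n%:R :> R by apply: lt_le_trans n2; rewrite divr_gt0.
have {}n2 : 2 <= eps * n%:R by rewrite mulrC -ler_pdivrMr.
have {}Ln : (C + 1) * L n <= eps * n%:R / 4.
  move: Ln; rewrite mulrAC ler_pdivlMr; last lra.
  by move=> H; lra.
have CL : C * L n <= eps * n%:R / 4.
  have [L0|L0] := leP 0 (L n); first by move: Ln; lra.
  by apply: (@le_trans _ _ 0); [rewrite mulr_ge0_le0 // ltW | lra].
have {}mn : m%:R <= n%:R * (eps * n%:R / 4).
  by apply: le_trans mn _; rewrite mulrAC mulrC ler_pM2l.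
have E : (1 - eps) * n%:R ^+ 2 / 2 <= 'C(n, 2)%:R - m%:R.
  by rewrite bin2r; have := ler_pM2l n0 2 (eps * n%:R); rewrite n2 => /idP; nra.
have mN : (m < 'C(n, 2))%N.
  rewrite -(ltr_nat R) -subr_gt0; apply: lt_le_trans E.
  by rewrite !mulr_gt0 // ?exprn_gt0 //; lra.
by split=> //; rewrite natrB // ltnW.
Qed.

Lemma growth_le_expR (n m k : nat) (r eps : R) :
    (0 < n)%N -> 0 <= r -> eps < 1 -> (1 - eps) * n%:R ^+ 2 / 2 <= ('C(n, 2) - m)%:R ->
  growth n r m ^+ k <= expR (k%:R * (2 * r / ((1 - eps) * n%:R ^+ 2))).
Proof.
move=> n0 r0 e1 H; rewrite expRM_natl; apply: lerXn2r; rewrite ?nnegrE ?growth_ge0 ?expR_ge0 //.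
apply: le_trans (expR_ge1Dx _); rewrite lerD2l.
have q0 : 0 < (1 - eps) * n%:R ^+ 2 by rewrite mulr_gt0 ?exprn_gt0 ?ltr0n //; lra.
rewrite [2 * r]mulrC -mulrA; apply: ler_wpM2l => //.
have p1 : 0 < (1 - eps) * n%:R ^+ 2 / 2 by rewrite divr_gt0.
by rewrite -[leRHS]invf_div lef_pV2 ?posrE // (lt_le_trans p1 H).
Qed.

(** Bounds the exponent of [growth_le_expR] by [B * l], where [l] stands for [log n]; [growth] is
    then at most [n] to the power [B]. *)
Lemma exponent_le (m n l c r eps A B : R) :
    0 < n -> eps < 1 -> 0 <= l -> 0 <= m -> m <= c * n * l -> 0 <= r -> r <= A * n ->
    2 * c * A <= B * (1 - eps) ->
  m * (2 * r / ((1 - eps) * n ^+ 2)) <= B * l.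
Proof.
move=> n0 e1 l0 m0 mn r0 rA cAB.
have q0 : 0 < (1 - eps) * n ^+ 2 by rewrite mulr_gt0 ?exprn_gt0 //; lra.
rewrite mulrA ler_pdivrMr //.
apply: (@le_trans _ _ (c * n * l * (2 * (A * n)))).
  by apply: ler_pM => //; lra.
have -> : c * n * l * (2 * (A * n)) = (2 * c * A) * (l * n ^+ 2) by ring.
have -> : B * l * ((1 - eps) * n ^+ 2) = B * (1 - eps) * (l * n ^+ 2) by ring.
by apply: ler_wpM2r => //; rewrite mulr_ge0 // exprn_ge0 // ltW.
Qed.

Lemma near_informed_lower (delta eta : R) : 0 < delta -> delta < 1 -> 0 < eta ->
  \forall n \near \oo, forall (a b : 'I_n) m, a != b ->
    m%:R <= (1 - delta) * (2^-1 * n%:R * L n) ->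
    pr R m (fun s => b \in spread a s) <= eta.
Proof.
(* With this [eps], [(1 - delta) * (1 + eps) <= (1 - delta / 2) * (1 - eps)], so the growth is at
   most [n] to the power [1 - delta / 2], against [eps * n%:R] in [pr_informed]. *)
move=> d0 d1 e0; pose eps := delta / 4.
have eps0 : 0 < eps by rewrite divr_gt0.
have eps1 : eps < 1 by rewrite /eps; lra.
have d2 : 0 < delta / 2 by rewrite divr_gt0.
have C0 : 0 <= (1 - delta) / 2 by lra.
apply: filterS3 (near_pairs_left eps0 eps1 C0) (near_exp_le eps^-1 d2 e0) (near_ln_ge 0).
move=> n PL EX L0 a b m ab mn; have n0 : (0 < n)%N by case: n a {b ab mn PL EX L0} => [[]|].
have {}mn : m%:R <= (1 - delta) / 2 * n%:R * L n by move: mn; lra.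
have [mN H] := PL m mn; have nr : 0 < n%:R :> R by rewrite ltr0n.
have := pr_informed eps0 ab mN.
rewrite -ler_pdivlMl ?mulr_gt0 // => /le_trans; apply; apply: le_trans EX.
rewrite [(eps * _)^-1]invfM -[leLHS]mulrA; apply: ler_wpM2l; first by rewrite invr_ge0 ltW.
rewrite ler_pdivrMl // -[X in X * expR _]lnK ?posrE // -expRD.
apply: le_trans (growth_le_expR _ n0 _ eps1 H) _; first by rewrite mulr_ge0 //; lra.
rewrite ler_expR; apply: (@le_trans _ _ ((1 - delta / 2) * L n)); last lra.
apply: (exponent_le nr eps1 L0 _ mn (A := 1 + eps)) => //.
  by rewrite mulr_ge0 //; lra.
by rewrite /eps; nra.
Qed.

Lemma near_uncalled (delta eta : R) : 0 < delta -> delta < 1 -> 0 < eta ->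
  \forall n \near \oo, forall m,
    m%:R <= (1 - delta) / 2 * n%:R * L n ->
    pr R m (fun s : seq {set 'I_n} => uncalled s == finset.set0) <= eta.
Proof.
move=> d0 d1 e0; pose eps := delta / 4.
have eps0 : 0 < eps by rewrite divr_gt0.
have eps1 : eps < 1 by rewrite /eps; lra.
have d2 : 0 < delta / 2 by rewrite divr_gt0.
have C0 : 0 <= (1 - delta) / 2 by lra.
apply: filterS3 (near_pairs_left eps0 eps1 C0) (near_exp_le 1 d2 e0)
  (filterI (near_ln_ge 0) (nbhs_infty_ge 1)).
move=> n PL EX [L0 n0] m mn; have [mN H] := PL m mn.
have nr : 0 < n%:R :> R by rewrite ltr0n.
apply: le_trans (pr_no_uncalled R mN) _; apply: le_trans EX; rewrite mul1r.
rewrite mulrC ler_pdivrMl // -[X in X * expR _]lnK ?posrE // -expRD.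
apply: le_trans (growth_le_expR _ n0 _ eps1 H) _; first exact: ler0n.
rewrite ler_expR; apply: (@le_trans _ _ ((1 - delta / 2) * L n)); last lra.
apply: (exponent_le nr eps1 L0 _ mn (A := 1)) => //; first lra.
by rewrite /eps; nra.
Qed.

Lemma near_no_completion (delta eta : R) : 0 < delta -> delta < 1 -> 0 < eta ->
  \forall n \near \oo, forall (u : 'I_n) t m, (t <= m)%N ->
    m%:R <= 2 * n%:R * L n -> (m - t)%:R <= (1 - delta) * n%:R * L n ->
    pr R m (fun s => (u \in uncalled (take t s)) && (spread u s == finset.setT))
      <= eta / n%:R.
Proof.
move=> d0 d1 e0; pose eps := delta / 16.
have eps0 : 0 < eps by rewrite divr_gt0.
have eps1 : eps < 1 by rewrite /eps; lra.
(* Up to a constant the bound is [n] to the power [- k * delta], hence at most [n ^- 2]: enough for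
   [eta / n%:R], which allows a union over the agents. *)
pose k := (Num.truncn (2 / delta)).+1.
have kd : 2 <= k%:R * delta.
  by rewrite -ler_pdivrMr //; apply: ltW; apply: truncnS_gt.
have k1 : 1 <= k%:R :> R by rewrite ler1n.
apply: filterS3 (near_pairs_left eps0 eps1 (ler0n R 2))
  (near_exp_le ((k%:R ^+ k) ^+ 2) (ltr01 : 0 < (1 : R)) e0)
  (filterI (near_ln_ge 0) (nbhs_infty_ger (k%:R / eps))).
move=> n PL EX [L0 kn] u t m tm mn mtn; have [mN H] := PL m mn.
have n0 : (0 < n)%N by case: n u {mn mtn mN H PL EX L0 kn} => [[]|].
have nr : 0 < n%:R :> R by rewrite ltr0n.
apply: le_trans (pr_uncalled_then_all R u k tm mN) _.
have K0 : 0 <= (k%:R ^+ k) ^+ 2 :> R by rewrite exprn_ge0 // exprn_ge0.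
rewrite ler_pdivlMr //; apply: le_trans EX; rewrite mul1r !exprMn exprVn exprVn.
move: ((k%:R ^+ k) ^+ 2) K0 => K K0; rewrite -!mulrA; apply: ler_wpM2l => //.
have ninv : (n%:R ^+ k) ^- 2 = expR (- (2 * k%:R * L n)).
  by rewrite expRN -natrM expRM_natl lnK ?posrE // mulnC exprM.
rewrite ninv.
have gr : growth n (k%:R * (n + k)%:R) m ^+ (m - t) <= expR (2 * k%:R * (1 - delta / 2) * L n).
  apply: le_trans (growth_le_expR _ n0 _ eps1 H) _; first by rewrite mulr_ge0.
  rewrite ler_expR; apply: (exponent_le nr eps1 L0 _ mtn (A := k%:R * (1 + eps))) => //.
    rewrite -mulrA; apply: ler_wpM2l; first lra.
    by rewrite natrD; move: kn; rewrite ler_pdivrMr //; lra.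
  rewrite (_ : 2 * (1 - delta) * (k%:R * (1 + eps)) =
      k%:R * (2 * (1 - delta) * (1 + eps))); last ring.
  rewrite (_ : _ * (1 - eps) = k%:R * (2 * (1 - delta / 2) * (1 - eps))); last ring.
  by apply: ler_wpM2l; [lra | rewrite /eps; nra].
apply: (@le_trans _ _ (expR (- (2 * k%:R * L n)) *
   (expR (2 * k%:R * (1 - delta / 2) * L n) * expR (L n)))).
  apply: ler_wpM2l; first exact: expR_ge0.
  by rewrite lnK ?posrE // ler_wpM2r // ltW.
rewrite -!expRD ler_expR.
have : 2 * L n <= k%:R * delta * L n by apply: ler_wpM2r.
by lra.
Qed.

Lemma near_high_degree (eps eta : R) : 0 < eps -> 0 < eta ->
  \forall n \near \oo, forall m, m%:R <= 3 * n%:R * L n ->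
    pr R m (fun s : seq {set 'I_n} => ~~ low_degree (Num.truncn (eps * n%:R)) s) <= eta.
Proof.
move=> eps0 e0.
have h0 : 0 < 2^-1 :> R by rewrite invr_gt0.
have h1 : 2^-1 < 1 :> R by rewrite invf_lt1 // ltr1n.
have l2 : 0 < L 2 by rewrite ln_gt0 // ltr1n.
(* The union over agents and the growth cost [n ^+ 13]. As [D] is at least [eps * n / 2], the
   constant 28 makes [2 ^+ D] at least [n ^+ 14]. *)
have q0 : 0 < eps * L 2 / 28 by rewrite !mulr_gt0.
apply: filterS3 (near_pairs_left h0 h1 (ler0n R 3)) (near_exp_le 1 (ltr01 : 0 < (1 : R)) e0)
  (filterI (filterI (near_ln_ge 0) (nbhs_infty_ge 1))
    (filterI (near_ln_le q0) (nbhs_infty_ger (2 / eps)))).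
move=> n PL EX [[L0 n0] [Ln ne]] m mn; have [mN H] := PL m mn.
have nr : 0 < n%:R :> R by rewrite ltr0n.
apply: le_trans (pr_high_degree R _ mN) _; apply: le_trans EX; rewrite !mul1r.
set D := Num.truncn _.
have DL : (eps * n%:R - 1) * L 2 <= D%:R * L 2.
  apply: ler_wpM2r; first exact: ltW.
  by have := truncnS_gt (eps * n%:R); rewrite -/D -natr1; lra.
have -> : 2 ^+ D = expR (D%:R * L 2) :> R by rewrite expRM_natl lnK // posrE.
rewrite -expRN.
have gr : growth n n%:R m ^+ m <= expR (12 * L n).
  apply: le_trans (growth_le_expR _ n0 _ h1 H) _; first exact: ler0n.
  rewrite ler_expR; apply: (exponent_le nr h1 L0 _ mn (A := 1)) => //; lra.
apply: (@le_trans _ _ (expR (L n) * expR (12 * L n) * expR (- (D%:R * L 2)))).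
  apply: ler_wpM2r; first exact: expR_ge0.
  by rewrite lnK ?posrE // ler_wpM2l // ltW.
rewrite -!expRD ler_expR.
have : 2 * L 2 <= eps * n%:R * L 2 by apply: ler_wpM2r; [exact: ltW | rewrite mulrC -ler_pdivrMr].
by lra.
Qed.

(** The shrinking rate [rho] is about [2 / n], so the power is about [n] to the minus
    [j * (1 + delta / 2)], and the prefactor of [pr_uninformed] costs one [n]. The [- 1] on the
    number of calls leaves room for rounding down; it is paid for by [expR 2]. *)
Lemma near_uninformed (delta eta : R) (j : nat) : 0 < delta -> delta <= 2^-1 -> 0 < eta ->
    (0 < j <= 3)%N ->
  \forall n \near \oo, forall (a b : 'I_n) m, a != b ->
    (1 + delta) * (j%:R / 2 * n%:R * L n) - 1 <= m%:R <= 3 * n%:R * L n ->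
    pr R m (fun s => low_degree (Num.truncn (delta / 16 * n%:R)) s && (b \notin spread a s))
      <= eta / n%:R ^+ j.-1.
Proof.
move=> d0 dh e0 /andP[j0 j3]; set eps := delta / 16.
have eps0 : 0 < eps by rewrite divr_gt0.
have eps1 : eps < 1 by rewrite /eps; lra.
have h0 : 0 < 2^-1 :> R by rewrite invr_gt0.
have h1 : 2^-1 < 1 :> R by rewrite invf_lt1 // ltr1n.
have d2 : 0 < delta / 2 by rewrite divr_gt0.
apply: filterS3 (near_pairs_left h0 h1 (ler0n R 3)) (near_exp_le (expR 2 / eps) d2 e0)
  (filterI (near_ln_ge 0) (nbhs_infty_ger (1 / eps))).
move=> n PL EX [L0 ne] a b m ab /andP[nm mn]; have [mN H] := PL m mn.
have n0 : (0 < n)%N by case: n a {b ab nm mn mN H PL EX L0 ne} => [[]|].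
have nr : 0 < n%:R :> R by rewrite ltr0n.
have {}ne : 1 <= eps * n%:R by rewrite mulrC -ler_pdivrMr.
set D := Num.truncn _.
have De : D%:R <= eps * n%:R by rewrite truncn_le ltW // mulr_gt0.
have en : eps * n%:R <= 32^-1 * n%:R.
  by apply: ler_wpM2r; [exact: ltW | rewrite /eps; lra].
have Dn : (D.*2 < n)%N.
  by rewrite -(ltr_nat R) -mul2n natrM; lra.
apply: le_trans (pr_uninformed eps0 eps1 ab (ltnW mN) Dn) _.
have nj : n%:R ^+ j.-1 * n%:R = expR (j%:R * L n).
  by rewrite -exprSr prednK // expRM_natl lnK // posrE.
rewrite ler_pdivlMr ?exprn_gt0 //.
set rho := _ / 'C(n, 2)%:R.
have Np : 0 < 'C(n, 2)%:R :> R by rewrite ltr0n; case: 'C(n, 2) mN.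
(* One [eps] is lost to the factor [1 - eps], and three since both [1] and [D] are at most
   [eps * n]. *)
have rhoge : 2 * (1 - 4 * eps) <= rho * n%:R.
  rewrite /rho mulrAC ler_pdivlMr // bin2r.
  have q : (1 - 3 * eps) * n%:R <= n%:R - 1 - 2 * D%:R by lra.
  apply: (@le_trans _ _ ((1 - eps) * ((1 - 3 * eps) * n%:R) * n%:R)); last first.
    by apply: ler_wpM2r; [exact: ltW | apply: ler_wpM2l => //; lra].
  have e14 : 0 <= 1 - 4 * eps by rewrite /eps; lra.
  have : 0 <= eps ^+ 2 * n%:R ^+ 2 by rewrite mulr_ge0 // exprn_ge0 // ltW.
  have : 0 <= (1 - 4 * eps) * n%:R by rewrite mulr_ge0 // ltW.
  rewrite !expr2; lra.
have rho1 : 0 <= rho.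
  rewrite -(pmulr_lge0 _ nr); apply: le_trans rhoge; rewrite /eps; lra.
have rhole1 : rho <= 1.
  rewrite /rho ler_pdivrMr // mul1r.
  have D0 : 0 <= D%:R :> R by [].
  have : (n - 1)%:R <= 'C(n, 2)%:R :> R.
    by rewrite ler_nat leq_subn1_bin2.
  rewrite natrB // => H1.
  have : (1 - eps) * (n%:R - 1 - 2 * D%:R) <= n%:R - 1 - 2 * D%:R.
    by apply: ler_piMl; [lra | lra].
  by lra.
clearbody rho.
have pw : (1 - rho) ^+ m <= expR (- (rho * m%:R)).
  rewrite [rho * _]mulrC -mulrN expRM_natl.
  apply: lerXn2r; rewrite ?nnegrE ?expR_ge0 ?subr_ge0 //; exact: expR_ge1Dx.
have key : j%:R * L n * (1 + delta / 2) - 2 <= rho * m%:R.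
  apply: (@le_trans _ _ (rho * ((1 + delta) * (j%:R / 2 * n%:R * L n) - 1))); last first.
    exact: ler_wpM2l.
  rewrite mulrBr mulr1; apply: lerB.
    rewrite (_ : rho * _ = rho * n%:R * ((1 + delta) / 2 * (j%:R * L n))); last by field.
    have jl : 0 <= j%:R * L n by rewrite mulr_ge0.
    apply: (@le_trans _ _ (2 * (1 - 4 * eps) * ((1 + delta) / 2 * (j%:R * L n)))).
      rewrite (_ : 2 * _ * _ = (1 - 4 * eps) * (1 + delta) * (j%:R * L n)); last by field.
      by rewrite mulrC; apply: ler_wpM2r => //; rewrite /eps; nra.
    by apply: ler_wpM2r => //; rewrite !mulr_ge0 //; lra.
  lra.
apply: le_trans EX.
have reorder (x y z w : R) : x * y * z * w = y * (w * x * z) by ring.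
rewrite reorder.
rewrite nj [expR 2 / eps]mulrC -[leRHS]mulrA; apply: ler_wpM2l; first by rewrite invr_ge0 ltW.
apply: (@le_trans _ _ (expR (j%:R * L n) * expR (- (rho * m%:R)))).
  by apply: ler_wpM2l; rewrite ?expR_ge0.
rewrite -!expRD ler_expR.
have : delta / 2 * L n <= delta / 2 * (j%:R * L n).
  by apply: ler_wpM2l; [exact: ltW | rewrite ler_peMl // ler1n].
by lra.
Qed.

End Asymptotics.

(** * From the state after [m] calls to [calls_until] *)

Section CallsUntil.
Variable n : nat.
Implicit Types (Q : pred (knowledge n)) (s : seq {set 'I_n}).

(** Knowledge only grows, so an upward property persists; its failure after [m] calls then excludes
    every earlier success. *)
Definition upward Q := forall K K' : knowledge n,
  (forall a, K a \subset K' a) -> Q K -> Q K'.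

Lemma knowledge_after_take t m s a : (t <= m)%N ->
  knowledge_after (take t s) a \subset knowledge_after (take m s) a.
Proof.
move=> tm; rewrite -(subnKC tm) takeD /knowledge_after foldl_cat.
exact: foldl_make_call_mono.
Qed.

Lemma calls_until_le_take Q s m : (m <= size s)%N ->
  Q (knowledge_after (take m s)) -> (calls_until Q s <= m)%N.
Proof.
move=> ms Qm; rewrite leqNgt; apply/negP => /(before_find 0%N).
by rewrite nth_iota // add0n Qm.
Qed.

Lemma calls_until_gt_take Q s m : upward Q -> (m <= size s)%N ->
  ~~ Q (knowledge_after (take m s)) -> (m < calls_until Q s)%N.
Proof.
move=> upQ ms; rewrite ltnNge; apply: contra => le_m.
(* Being below the default value, [calls_until] is a time at which [Q] really holds. *)
have lt_s : (calls_until Q s < (size s).+1)%N by rewrite ltnS (leq_trans le_m).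
have := lt_s; rewrite -[ltnRHS](size_iota 0) -has_find => /(nth_find 0%N).
rewrite -/(calls_until Q s) nth_iota // add0n; apply: upQ => a; exact: knowledge_after_take.
Qed.

Lemma upward_exchanged a b : upward (exchanged a b).
Proof.
move=> K K' KK' /andP[/(fintype.subsetP (KK' a)) aK /(fintype.subsetP (KK' b)) bK].
exact/andP.
Qed.

Lemma upward_expert a : upward (expert a).
Proof. by move=> K K' KK' /eqP Ka; rewrite /expert -finset.subTset -Ka. Qed.

Lemma upward_some_expert : upward (@some_expert n).
Proof.
move=> K K' KK' /existsP[a Ka]; apply/existsP; exists a; exact: upward_expert Ka.
Qed.

Lemma upward_all_experts : upward (@all_experts n).
Proof.
move=> K K' KK' /forallP Ka; apply/forallP => a; exact: upward_expert (Ka a).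
Qed.

End CallsUntil.

(** * Passage to the limit, union bounds, and the four thresholds *)

Section Assembly.
Variable R : realType.
Local Notation L n := (ln (n%:R : R)).

Lemma near_add2 (P : nat -> Prop) :
  (\forall n \near \oo, P n) -> \forall n \near \oo, P n.+2.
Proof.
by case=> N _ H; exists N => // n Nn; apply: H => /=; rewrite (leq_trans Nn) // -addn2 leq_addr.
Qed.

Lemma pr_take n t m (A : pred (seq {set 'I_n})) : (t <= m)%N -> (m <= 'C(n, 2))%N ->
  pr R m (fun s => A (take t s)) = pr R t A.
Proof.
move=> tm mN; rewrite -(co_prob_pr R (fun s => A (take t s))) //.
rewrite -(co_prob_pr R A (leq_trans tm mN)).
by congr co_prob; apply/funext => s; rewrite take_takel.
Qed.

Lemma pr_rev n m (A : pred (seq {set 'I_n})) : (m <= 'C(n, 2))%N ->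
  pr R m (fun s => A (rev s)) = pr R m A.
Proof.
by move=> mN; rewrite -!co_prob_pr // co_prob_rev.
Qed.

Lemma co_mass_ge0 n (s : co_seq n) : 0 <= co_mass R s.
Proof. by apply: prodr_ge0 => i _; apply: co_step_ge0. Qed.

Lemma co_prob_le1 n (A : pred (co_seq n)) : co_prob A <= 1 :> R.
Proof.
rewrite -(co_prob_total n R) /co_prob [leLHS]big_mkcond; apply: ler_sum => s _.
by case: ifP => // _; apply: co_mass_ge0.
Qed.

Lemma co_prob_cover3 n (A B C : pred (co_seq n)) : (forall s, [|| A s, B s | C s]) ->
  1 <= co_prob A + co_prob B + co_prob C :> R.
Proof.
move=> ABC; rewrite -(co_prob_total n R) /co_prob.
rewrite [X in _ <= X + _ + _]big_mkcond [X in _ <= _ + X + _]big_mkcond [X in _ <= _ + X]big_mkcond.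
rewrite -!big_split /=; apply: ler_sum => s _; have := co_mass_ge0 s.
by have := ABC s; case: (A s); case: (B s); case: (C s) => //= _; lra.
Qed.

(** Concentration reduces to two one-time bounds: [Q] is unlikely just below the threshold and
    likely just above it. The wanted event and the two exceptional ones cover everything. *)
Lemma aas_asymp_calls_until (Q : forall n, pred (knowledge n.+2)) (c : R) (f : nat -> R) :
    0 < c -> c <= 3 / 2 -> (forall n, f n = c * n%:R * L n) ->
    (forall n, upward (Q n)) ->
    (forall delta eta, 0 < delta -> delta < 1 -> 0 < eta -> \forall n \near \oo,
      forall m, m%:R <= (1 - delta) * (c * n.+2%:R * L n.+2) ->
      pr R m (fun s => Q n (knowledge_after s)) <= eta) ->
    (forall delta eta, 0 < delta -> delta <= 2^-1 -> 0 < eta -> \forall n \near \oo,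
      forall m, (1 + delta) * (c * n.+2%:R * L n.+2) - 1 <= m%:R <= 3 * n.+2%:R * L n.+2 ->
      pr R m (fun s => ~~ Q n (knowledge_after s)) <= eta) ->
  aas_asymp (fun n s => calls_until (Q n) s) f.
Proof.
move=> c0 c32 fE upQ low up delta d0; pose d := Num.min delta 2^-1.
have h0 : 0 < 2^-1 :> R by rewrite invr_gt0.
have dd : 0 < d by rewrite lt_min d0 h0.
have dle : d <= delta by rewrite ge_min lexx.
have dh : d <= 2^-1 by rewrite ge_min lexx orbT.
have d1 : d < 1 by lra.
have h1 : 2^-1 < 1 :> R by lra.
apply/cvgrPdist_le => eps eps0; have e2 : 0 < eps / 2 by rewrite divr_gt0.
apply: filterS3 (low _ _ dd d1 e2) (up _ _ dd dh e2)
  (near_add2 (filterI (near_pairs_left h0 h1 (ler0n R 3)) (near_ln_ge 0))).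
move=> n lown upn [PL L0]; rewrite !fE.
set F := c * n.+2%:R * L n.+2 in lown upn *.
have F0 : 0 <= F by apply: mulr_ge0; [apply: mulr_ge0; [exact: ltW|] | exact: L0].
(* Since [d <= 2^-1] and [c <= 3 / 2], the product [(1 + d) * c] is at most [9 / 4]. *)
have F3 : (1 + d) * F <= 3 * n.+2%:R * L n.+2.
  rewrite (_ : _ * F = (1 + d) * c * (n.+2%:R * L n.+2)); last by rewrite /F; ring.
  rewrite -[leRHS]mulrA; apply: ler_wpM2r; [by apply: mulr_ge0; [|exact: L0] | nra].
have q1 : 0 <= (1 - d) * F by rewrite mulr_ge0 //; lra.
have q2 : 0 <= (1 + d) * F by rewrite mulr_ge0 //; lra.
pose m1 := Num.truncn ((1 - d) * F); pose m2 := Num.truncn ((1 + d) * F).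
have m1F : m1%:R <= (1 - d) * F by rewrite truncn_le.
have m2F : m2%:R <= (1 + d) * F by rewrite truncn_le.
have F1m : (1 - d) * F < m1%:R + 1 by rewrite natr1 truncnS_gt.
have F2m : (1 + d) * F < m2%:R + 1 by rewrite natr1 truncnS_gt.
have [m2N _] := PL m2 (le_trans m2F F3).
have m12 : (m1 <= m2)%N.
  by apply: le_truncn; apply: ler_wpM2r => //; lra.
have m1N : (m1 <= 'C(n.+2, 2))%N by rewrite (leq_trans m12) // ltnW.
have {}lown := lown m1 m1F.
have {}upn : pr R m2 (fun s => ~~ Q n (knowledge_after s)) <= eps / 2.
  by apply: upn; rewrite (le_trans m2F F3) andbT; lra.
rewrite -co_prob_pr // in lown; rewrite -co_prob_pr 1?ltnW // in upn.
rewrite ger0_norm ?subr_ge0 ?co_prob_le1 //.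
set P := co_prob _; suff : 1 <= P + eps / 2 + eps / 2 by lra.
apply: le_trans (lerD (lerD (lexx P) lown) upn); apply: co_prob_cover3 => s.
have [Q1|Q1] := boolP (Q n (knowledge_after (take m1 s))); first by rewrite !orbT.
have [Q2|Q2] := boolP (Q n (knowledge_after (take m2 s))); last by rewrite !orbT.
rewrite !orbF.
have := calls_until_gt_take (upQ n) (_ : m1 <= size s)%N Q1; rewrite size_tuple => /(_ m1N).
have := calls_until_le_take (_ : m2 <= size s)%N Q2; rewrite size_tuple => /(_ (ltnW m2N)).
rewrite -(ler_nat R) -[(m1 < _)%N](ler_nat R) -natr1 => X2 X1.
have dF : d * F <= delta * F by apply: ler_wpM2r.
by apply/andP; split; lra.
Qed.

Lemma mem_knowledge_after n (a b : 'I_n) s :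
  (b \in knowledge_after s a) = (a \in spread b s).
Proof. by rewrite inE. Qed.

(** Union bound over a family of pairs: two pairs with [j = 1] for an exchange, [n] with [j = 2] for
    one expert, all of them with [j = 3] for all experts. *)
Lemma near_uninformed_sum (delta eta : R) (j : nat) :
    0 < delta -> delta <= 2^-1 -> 0 < eta -> (0 < j <= 3)%N ->
  \forall n \near \oo, forall (I : finType) (p : I -> 'I_n * 'I_n) m,
    (#|I| <= 2 * n ^ j.-1)%N ->
    (1 + delta) * (j%:R / 2 * n%:R * L n) - 1 <= m%:R <= 3 * n%:R * L n ->
    pr R m (fun s => [exists i, (p i).2 \notin spread (p i).1 s]) <= eta.
Proof.
move=> d0 dh e0 j13; have e2 : 0 < eta / 2 by rewrite divr_gt0.
have e4 : 0 < eta / 4 by rewrite divr_gt0.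
have q0 : 0 < delta / 16 by rewrite divr_gt0.
apply: filterS3 (near_high_degree q0 e2) (near_uninformed d0 dh e4 j13) (nbhs_infty_ge 1).
move=> n HD UN n0 I p m cardI mn; set D := Num.truncn _ in HD UN.
have np : 0 < n%:R ^+ j.-1 :> R by rewrite exprn_gt0 // ltr0n.
apply: (@le_trans _ _ (pr R m (fun s => ~~ low_degree D s || [exists i,
    low_degree D s && ((p i).2 \notin spread (p i).1 s)]))).
  apply: pr_le => s _ _ /existsP[i pi]; case: (low_degree D s) => //=.
  by apply/existsP; exists i.
apply: le_trans (pr_or _ _ _ _) _.
rewrite [eta](_ : _ = eta / 2 + eta / 2); last lra.
apply: lerD; first by apply: HD; case/andP: mn.
apply: le_trans (pr_exists _ _ _) _.
apply: (@le_trans _ _ (\sum_(i : I) eta / 4 / n%:R ^+ j.-1)).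
  (* Diagonal pairs contribute 0, as every agent knows its own secret. *)
  apply: ler_sum => i _; have [pi|pi] := eqVneq (p i).1 (p i).2; last exact: UN.
  apply: (@le_trans _ _ 0); last by rewrite divr_ge0 // ltW.
  rewrite -[leLHS]mul1r /pr -expectZ.
  apply: (@le_trans _ _ (expect m [::] (fun s => 0 * (1 : R)))).
    by apply: expect_le => // s _ _; rewrite pi spread_self andbF mulr0 mul0r.
  by rewrite expectZ mul0r.
rewrite sumr_const -[leLHS]mulr_natr -mulrA.
rewrite [eta / 2](_ : _ = eta / 4 * 2); last lra.
apply: ler_wpM2l; first exact: ltW.
rewrite mulrC ler_pdivrMr //; apply: le_trans (_ : (2 * n ^ j.-1)%:R <= _).
  by rewrite ler_nat.
by rewrite natrM natrX.
Qed.

Lemma near_expert_upper (a : forall n, 'I_n.+2) (delta eta : R) :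
    0 < delta -> delta <= 2^-1 -> 0 < eta -> \forall n \near \oo,
  forall m, (1 + delta) * (1 * n.+2%:R * L n.+2) - 1 <= m%:R <= 3 * n.+2%:R * L n.+2 ->
  pr R m (fun s => ~~ expert (a n) (knowledge_after s)) <= eta.
Proof.
move=> d0 dh e0; have := near_uninformed_sum d0 dh e0 (isT : 0 < 2 <= 3)%N.
move=> /near_add2; apply: filterS => n H m mn.
apply: le_trans (H _ (fun b => (b, a n)) m _ _).
- apply: pr_le => s _ _; rewrite /expert -finset.subTset => /fintype.subsetPn[b _ nb].
  by apply/existsP; exists b; rewrite -mem_knowledge_after.
- by rewrite card_ord expn1 leq_pmull.
by rewrite divff.
Qed.

(** Time reversal turns an expert [u] into an agent whose secret has reached everyone, and
    [near_no_completion] applies with [t = 0], when every agent is uncalled. *)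
Lemma near_some_expert_lower (delta eta : R) :
    0 < delta -> delta < 1 -> 0 < eta -> \forall n \near \oo,
  forall m, m%:R <= (1 - delta) * (1 * n.+2%:R * L n.+2) ->
  pr R m (fun s => @some_expert n.+2 (knowledge_after s)) <= eta.
Proof.
move=> d0 d1 e0; have h0 : 0 < 2^-1 :> R by rewrite invr_gt0.
have h1 : 2^-1 < 1 :> R by rewrite invf_lt1 // ltr1n.
apply: filterS (near_add2 (filterI (near_no_completion d0 d1 e0)
  (filterI (near_pairs_left h0 h1 (ler0n R 2)) (near_ln_ge 0)))).
move=> n [NC [PL L0]] m mn.
have nL : 0 <= n.+2%:R * L n.+2 by apply: mulr_ge0; [exact: ler0n | exact: L0].
have dnL : 0 <= delta * (n.+2%:R * L n.+2) by apply: mulr_ge0; [exact: ltW|].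
have m2 : m%:R <= 2 * n.+2%:R * L n.+2 by lra.
have [mN _] := PL m m2; apply: le_trans (pr_exists _ _ _) _.
have n0 : n.+2%:R != 0 :> R by rewrite pnatr_eq0.
apply: (@le_trans _ _ (\sum_(u : 'I_n.+2) eta / n.+2%:R)); last first.
  by rewrite sumr_const card_ord -[leLHS]mulr_natr mulfVK.
apply: ler_sum => u _; rewrite -(pr_rev _ (ltnW mN)).
apply: le_trans (NC u 0%N m (leq0n _) m2 _); last by rewrite subn0; lra.
apply: pr_le => s _ _; rewrite /expert -spread_rev revK => ->.
by rewrite take0 inE.
Qed.

Lemma near_all_experts_lower (delta eta : R) :
    0 < delta -> delta < 1 -> 0 < eta -> \forall n \near \oo,
  forall m, m%:R <= (1 - delta) * (3 / 2 * n.+2%:R * L n.+2) ->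
  pr R m (fun s => @all_experts n.+2 (knowledge_after s)) <= eta.
Proof.
move=> d0 d1 e0; have h0 : 0 < 2^-1 :> R by rewrite invr_gt0.
have h1 : 2^-1 < 1 :> R by rewrite invf_lt1 // ltr1n.
have d20 : 0 < delta / 2 by lra.
have d21 : delta / 2 < 1 by lra.
have e2 : 0 < eta / 2 by lra.
apply: filterS (near_add2 (filterI (filterI (near_no_completion d20 d21 e2)
  (near_uncalled d0 d1 e2)) (filterI (near_pairs_left h0 h1 (ler0n R 2))
  (filterI (near_ln_ge 1) (nbhs_infty_ger (2 / delta)))))).
move=> n [[NC UC] [PL [L1 nd]]] m mn.
have n0 : n.+2%:R != 0 :> R by rewrite pnatr_eq0.
have nL : n.+2%:R <= n.+2%:R * L n.+2 by apply: ler_peMr; [exact: ler0n | exact: L1].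
have n00 : 0 <= n.+2%:R :> R by [].
(* Half of this absorbs the 1 lost when [T] is rounded down. *)
have dnL : 2 <= delta * (n.+2%:R * L n.+2).
  by rewrite mulrC -ler_pdivrMr // (le_trans nd).
have m2 : m%:R <= 2 * n.+2%:R * L n.+2 by lra.
have [mN _] := PL m m2.
pose T := Num.truncn ((1 - delta) / 2 * n.+2%:R * L n.+2).
have T0 : 0 <= (1 - delta) / 2 * n.+2%:R * L n.+2.
  by rewrite -mulrA mulr_ge0 //; lra.
have TL : T%:R <= (1 - delta) / 2 * n.+2%:R * L n.+2 by rewrite truncn_le.
have TG : (1 - delta) / 2 * n.+2%:R * L n.+2 < T%:R + 1 by rewrite natr1 truncnS_gt.
(* An agent is likely to be uncalled up to [T], and at most [(1 - delta / 2) * n log n] calls remain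
   afterwards; the minimum covers the case where [m] is below [T]. *)
pose t := minn m T; have tm : (t <= m)%N by rewrite geq_minl.
have tL : t%:R <= (1 - delta) / 2 * n.+2%:R * L n.+2.
  by apply: le_trans TL; rewrite ler_nat geq_minr.
have mtL : (m - t)%:R <= (1 - delta / 2) * n.+2%:R * L n.+2.
  rewrite natrB // /t; case: (leqP m T) => [_|_]; last by lra.
  rewrite subrr -mulrA mulr_ge0 //; lra.
apply: (@le_trans _ _ (pr R m (fun s : seq {set 'I_n.+2} =>
   (uncalled (take t s) == finset.set0) || [exists u,
     (u \in uncalled (take t s)) && (spread u s == finset.setT)]))).
  apply: pr_le => s _ _ /forallP Ks; have [//|/finset.set0Pn[u us]] := eqVneq.
  apply/existsP; exists u; rewrite us /= -finset.subTset.
  apply/fintype.subsetP => y _; rewrite -mem_knowledge_after.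
  by have /eqP-> := Ks y; rewrite finset.in_setT.
apply: le_trans (pr_or _ _ _ _) _.
rewrite [eta](_ : _ = eta / 2 + eta / 2); last lra.
apply: lerD.
  by rewrite (pr_take (fun s => uncalled s == finset.set0)) ?UC // ltnW.
apply: le_trans (pr_exists _ _ _) _.
apply: (@le_trans _ _ (\sum_(u : 'I_n.+2) eta / 2 / n.+2%:R)); last first.
  by rewrite sumr_const card_ord -[leLHS]mulr_natr mulfVK.
by apply: ler_sum => u _; apply: NC.
Qed.

End Assembly.

Theorem theorem6p4 (R : realType) (a b : forall n : nat, 'I_n.+2)
    (hab : forall n : nat, a n != b n) :
  [/\ aas_asymp (fun n s => calls_until (exchanged (a n) (b n)) s)
        (fun n : nat => 2^-1 * n%:R * ln (n%:R : R)),
      aas_asymp (fun n s => calls_until (@some_expert n.+2) s)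
        (fun n : nat => n%:R * ln (n%:R : R)),
      aas_asymp (fun n s => calls_until (expert (a n)) s)
        (fun n : nat => n%:R * ln (n%:R : R))
    & aas_asymp (fun n s => calls_until (@all_experts n.+2) s)
        (fun n : nat => 3 / 2 * n%:R * ln (n%:R : R))].
Proof.
split.
- apply: (@aas_asymp_calls_until _ (fun n => exchanged (a n) (b n)) 2^-1) => //.
  + by lra.
  + by move=> n; apply: upward_exchanged.
  + move=> d eta d0 d1 e0.
    apply: filterS (near_add2 (near_informed_lower d0 d1 e0)) => n H m mn.
    apply: le_trans (H (b n) (a n) m _ mn); last by rewrite eq_sym.
    by apply: pr_le => s _ _ /andP[+ _]; rewrite mem_knowledge_after.
  + move=> d eta d0 dh e0.
    have := near_uninformed_sum d0 dh e0 (isT : 0 < 1 <= 3)%N.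
    move=> /near_add2; apply: filterS => n H m mn.
    apply: le_trans (H _ (fun i : bool => if i then (a n, b n) else (b n, a n)) m _ _).
    * apply: pr_le => s _ _; rewrite /exchanged !mem_knowledge_after negb_and.
      by case/orP => H'; apply/existsP; [exists false | exists true].
    * by rewrite card_bool.
    * by rewrite mul1r.
- apply: (@aas_asymp_calls_until _ (fun n => @some_expert n.+2) 1) => //.
  + by lra.
  + by move=> n; rewrite mul1r.
  + by move=> n; apply: upward_some_expert.
  + exact: near_some_expert_lower.
  (* Some expert exists as soon as [a n] is one. *)
  + move=> d eta d0 dh e0; apply: filterS (near_expert_upper a d0 dh e0) => n H m mn.
    apply: le_trans (H m mn); apply: pr_le => s _ _; apply: contra => ea.
    by apply/existsP; exists (a n).
- apply: (@aas_asymp_calls_until _ (fun n => expert (a n)) 1) => //.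
  + by lra.
  + by move=> n; rewrite mul1r.
  + by move=> n; apply: upward_expert.
  (* Conversely, [a n] cannot be an expert before the first expert appears, so both thresholds
     coincide. *)
  + move=> d eta d0 d1 e0; apply: filterS (near_some_expert_lower d0 d1 e0) => n H m mn.
    apply: le_trans (H m mn); apply: pr_le => s _ _ ea.
    by apply/existsP; exists (a n).
  + exact: near_expert_upper.
- apply: (@aas_asymp_calls_until _ (fun n => @all_experts n.+2) (3 / 2)) => //.
  + by move=> n; apply: upward_all_experts.
  + exact: near_all_experts_lower.
  + move=> d eta d0 dh e0.
    have := near_uninformed_sum d0 dh e0 (isT : 0 < 3 <= 3)%N.
    move=> /near_add2; apply: filterS => n H m mn.
    apply: le_trans (H _ (fun p : 'I_n.+2 * 'I_n.+2 => p) m _ mn).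
    * apply: pr_le => s _ _; rewrite negb_forall => /existsP[y].
      rewrite /expert -finset.subTset => /fintype.subsetPn[x _ nx].
      by apply/existsP; exists (x, y); rewrite -mem_knowledge_after.
    * by rewrite card_prod card_ord mulnn leq_pmull.
Qed.
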